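(* Let $d \geq 4$. The Aperiodic Domino problem for $\mathbb{Z}^d$ subshifts of finite type — given as input a finite family $\mathcal{F}$ of $d$-dimensional patterns, decide whether the SFT $X_{\mathcal{F}}$ contains an aperiodic configuration — is $\Sigma_1^1$-complete (under many-one reductions).
   Context: Let $\Sigma$ be a finite alphabet. A configuration is a map $c:\mathbb{Z}^d\to\Sigma$; a pattern is a map $w:D\to\Sigma$ with $D\subseteq\mathbb{Z}^d$ finite; $w$ appears in $x$ if there is $i$ with $x_{i+j}=w_j$ for all $j\in D$. For a family $\mathcal{F}$ of patterns, $X_{\mathcal{F}}$ is the set of configurations in which no pattern of $\mathcal{F}$ appears; when $\mathcal{F}$ is finite, $X_{\mathcal{F}}$ is a subshift of finite type (SFT). A vector $p\in\mathbb{Z}^d$ is broken in $x$ if $x_{i+p}\neq x_i$ for some $i$; $x$ is aperiodic if every nonzero vector $p\in\mathbb{Z}^d$ is broken in $x$. A decision problem $P$ on $\mathbb{N}$ is $\Sigma_1^1$ if there is an arithmetical relation $R$ with $P(n)=1 \iff \exists f\in 2^{\mathbb{N}}, R^f(n)$ ($R$ relativized to oracle $f$); it is $\Sigma_1^1$-complete if it is $\Sigma_1^1$ and every $\Sigma_1^1$ problem many-one reduces to it. *)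

(* Defs.v *)
From mathcomp Require Import all_boot all_order all_algebra.
From mathcomp Require Import finmap.

Set Implicit Arguments.
Unset Strict Implicit.
Unset Printing Implicit Defensive.

Import GRing.Theory.

Local Open Scope ring_scope.
Local Open Scope fmap_scope.

Definition Zd (d : nat) := 'rV[int]_d.

Definition config (d : nat) (S : finType) := Zd d -> S.

(* A map w : D -> S on a finite domain D = domf w. *)
Definition pattern (d : nat) (S : finType) := {fmap Zd d -> S}.

Definition appears d (S : finType) (w : pattern d S) (x : config d S) : Prop :=
  exists i : Zd d, forall (j : Zd d) (hj : j \in domf w), x (i + j) = w.[hj].

Definition SFT d (S : finType) (F : seq (pattern d S)) (x : config d S) : Prop :=
  forall w, w \in F -> ~ appears w x.

Definition broken d (S : finType) (p : Zd d) (x : config d S) : Prop :=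
  exists i : Zd d, x (i + p) <> x i.

Definition aperiodic d (S : finType) (x : config d S) : Prop :=
  forall p : Zd d, p <> 0 -> broken p x.

(* An instance, as finite data: the size k of the alphabet 'I_k, and for each
   pattern the list of its (position, symbol) pairs. *)
Definition instance (d : nat) :=
  {k : nat & seq (seq (d.-tuple int * 'I_k))}.

(* If a position is listed several times, its first occurrence wins; every
   finite family of patterns is the image of some instance. *)
Definition pattern_of d k (s : seq (d.-tuple int * 'I_k)) : pattern d 'I_k :=
  foldr (fun ja w => w.[(\row_(i < d) tnth ja.1 i) <- ja.2]) [fmap] s.

Definition family_of d (I : instance d) : seq (pattern d 'I_(tag I)) :=
  map (@pattern_of d (tag I)) (tagged I).

(* Instances are numbered by their pickle, an explicit iteration of CodeSeq.code;
   numbers that code no instance are negative. *)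
Definition aperiodic_domino (d : nat) (n : nat) : Prop :=
  exists I : instance d, n = choice.pickle I /\
    exists x : config d 'I_(tag I), SFT (family_of I) x /\ aperiodic x.

Local Open Scope nat_scope.

Definition oracle := nat -> bool.

Definition functional (n : nat) := oracle -> n.-tuple nat -> nat.

(* The total general recursive functionals: the oracle f is queried through
   recf_oracle only, so one program F serves all oracles at once.  In recf_prec
   the recursion variable comes first, and h receives (counter, previous value,
   parameters); recf_min is minimisation of a regular functional. *)
Inductive recursive : forall n : nat, functional n -> Prop :=
| recf_zero : recursive (fun _ (_ : 0.-tuple nat) => 0)
| recf_succ : recursive (fun _ (v : 1.-tuple nat) => (thead v).+1)
| recf_oracle : recursive (fun f (v : 1.-tuple nat) => nat_of_bool (f (thead v)))
| recf_proj n (i : 'I_n) : recursive (fun _ (v : n.-tuple nat) => tnth v i)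
| recf_comp m n (g : functional m) (h : 'I_m -> functional n) :
    recursive g -> (forall i, recursive (h i)) ->
    recursive (fun f (v : n.-tuple nat) => g f [tuple h i f v | i < m])
| recf_prec n (g : functional n) (h : functional n.+2) :
    recursive g -> recursive h ->
    recursive (fun f (v : n.+1.-tuple nat) =>
      let u : n.-tuple nat := [tuple of behead v] in
      iteri (thead v) (fun k r => h f [tuple of k :: r :: u]) (g f u))
| recf_min n (g : functional n.+1)
    (reg : forall f (v : n.-tuple nat), exists m, g f [tuple of m :: v] == 0) :
    recursive g -> recursive (fun f (v : n.-tuple nat) => ex_minn (reg f v)).

(* Recursive relative to the empty oracle. *)
Definition computable (g : nat -> nat) : Prop :=
  exists F : functional 1, recursive F /\
    forall n, F (fun _ => false) [tuple n] = g n.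

(* Relations R^f(v) obtained by a finite prefix of number quantifiers from a
   relation recursive in f, given by its characteristic functional. *)
Inductive arithmetical : forall n : nat, (oracle -> n.-tuple nat -> Prop) -> Prop :=
| arith_rec n (F : functional n) :
    recursive F -> arithmetical (fun f (v : n.-tuple nat) => F f v = 1)
| arith_ex n (R : oracle -> n.+1.-tuple nat -> Prop) :
    arithmetical R ->
    arithmetical (fun f (v : n.-tuple nat) => exists m, R f [tuple of m :: v])
| arith_all n (R : oracle -> n.+1.-tuple nat -> Prop) :
    arithmetical R ->
    arithmetical (fun f (v : n.-tuple nat) => forall m, R f [tuple of m :: v]).

Definition Sigma11 (P : nat -> Prop) : Prop :=
  exists R : oracle -> 1.-tuple nat -> Prop, arithmetical R /\
    forall n, P n <-> exists f : oracle, R f [tuple n].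

Definition many_one_reducible (Q P : nat -> Prop) : Prop :=
  exists g : nat -> nat, computable g /\ forall n, Q n <-> P (g n).

Definition Sigma11_complete (P : nat -> Prop) : Prop :=
  Sigma11 P /\ forall Q, Sigma11 Q -> many_one_reducible Q P.

(* Main.v *)
Require Import Defs.
From mathcomp Require Import all_boot.
From Stdlib Require Import Classical FunctionalExtensionality PropExtensionality ClassicalEpsilon.
From mathcomp Require Import all_order all_algebra finmap zify.

(* Membership: a configuration is coded by an oracle, and "avoids the patterns" and
   "every nonzero vector is broken" are first-order conditions on that oracle.

   Hardness: storing in the oracle the set of true instances of every subformula
   turns a Sigma^1_1 predicate Q into "exists h, forall m, exists k, G h n m k = 1"
   with G recursive.  A register machine with oracle h then enters a state mu with
   the value m in register rho, for m = 0, 1, 2, ... in turn, as long as it finds a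
   suitable k; so Q(n) holds iff the values marked in this way are unbounded for
   some h.  In Z^d, write x, y, z and w for the axis 0, 1, 2 and the remaining ones.
   The quadrant x, y >= 0 at a seed carries the run: row y shows the state and the
   registers (in unary) at time y, column x the bit h(x); this is constant in z and w.
   A row in state mu carries a closed loop of length 2(v+1) over the cells x <= v, v
   being the value of rho, in which signals move by one cell when z increases by one.
   So the z-periods of the row are the multiples of some divisor of 2(v+1): if the
   marked values are below B, then 2 B! is a z-period of everything, and if they are
   unbounded, suitable signals break every z-period.  Periods along x and y are broken
   by the uniqueness of the seed, and periods along w by a bit which is free to depend
   on w, but only at the seed: hence configurations without seed are periodic, and the
   spurious runs that they may contain are harmless. *)

Set Implicit Arguments.
Unset Strict Implicit.
Unset Printing Implicit Defensive.

Import Order.TTheory GRing.Theory Num.Theory.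

Local Open Scope nat_scope.

Local Notation pickle := choice.pickle.

(** * Recursive terms and arithmetical formulas *)

(** Only the quantified tuple knows the arity: [E] acts on plain sequences, so that arguments can be
    added or dropped without casts between tuple types. *)
Definition recS n (E : oracle -> seq nat -> nat) : Prop :=
  recursive (fun f (v : n.-tuple nat) => E f v).

Lemma recursive_ext n (F G : functional n) :
  (forall f v, F f v = G f v) -> recursive F -> recursive G.
Proof.
move=> FG; suff -> : F = G by [].
by do 2![apply: functional_extensionality => ?]; apply: FG.
Qed.

Lemma arithmetical_ext n (R S : oracle -> n.-tuple nat -> Prop) :
  (forall f v, R f v <-> S f v) -> arithmetical R -> arithmetical S.
Proof.
move=> RS; suff -> : R = S by [].
do 2![apply: functional_extensionality => ?].
by apply: propositional_extensionality; apply: RS.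
Qed.

Lemma recS_var n i : recS n (fun _ s => nth 0 s i).
Proof.
case: (ltnP i n) => [lt_in | le_ni].
  apply: recursive_ext (recf_proj (Ordinal lt_in)) => f v.
  by rewrite (tnth_nth 0).
(* [recf_zero] has arity 0; composed with an empty family it gives the zero of arity [n], the
   default value of a variable out of range. *)
have rH (j : 'I_0) : recursive (fun (_ : oracle) (_ : n.-tuple nat) => 0) by case: j.
have Z := recf_comp recf_zero rH.
by apply: recursive_ext Z => f v; rewrite nth_default ?size_tuple.
Qed.

Lemma recS_comp n m (G : oracle -> seq nat -> nat) (H : oracle -> seq nat -> seq nat) :
    (forall f (v : n.-tuple nat), size (H f v) = m) -> recS m G ->
    (forall i, i < m -> recS n (fun f s => nth 0 (H f s) i)) ->
  recS n (fun f s => G f (H f s)).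
Proof.
move=> szH rG rH.
apply: recursive_ext (recf_comp rG (fun i : 'I_m => rH i (ltn_ord i))) => f v.
congr (G f _); apply: (@eq_from_nth _ 0) => [|i]; first by rewrite size_tuple szH.
rewrite size_tuple => lt_im.
have -> : i = Ordinal lt_im by [].
by rewrite -tnth_nth tnth_mktuple.
Qed.

Definition rec1 (g : oracle -> nat -> nat) :=
  recS 1 (fun f s => g f (nth 0 s 0)).
Definition rec2 (g : oracle -> nat -> nat -> nat) :=
  recS 2 (fun f s => g f (nth 0 s 0) (nth 0 s 1)).

(** The function symbols are arbitrary functionals packed with a proof that they are recursive. To
    prove a new function recursive it then suffices to exhibit a term, and the function becomes a
    symbol in its turn. *)
Inductive term : Type :=
| Var of nat
| Ap1 (g : oracle -> nat -> nat) of rec1 g & term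
| Ap2 (g : oracle -> nat -> nat -> nat) of rec2 g & term & term.

Fixpoint eval (f : oracle) (s : seq nat) (t : term) : nat :=
  match t with
  | Var i => nth 0 s i
  | Ap1 g _ t1 => g f (eval f s t1)
  | Ap2 g _ t1 t2 => g f (eval f s t1) (eval f s t2)
  end.

Lemma evalP n t : recS n (fun f s => eval f s t).
Proof.
elim: t => [i | g rg t IHt | g rg t IHt u IHu] /=; first exact: recS_var.
  by apply: (@recS_comp n 1 _ (fun f s => [:: eval f s t]) _ rg) => // -[].
by apply: (@recS_comp n 2 _ (fun f s => [:: eval f s t; eval f s u]) _ rg)
  => // -[|[]].
Qed.

Lemma recS_term n t (E : oracle -> seq nat -> nat) :
  (forall f (v : n.-tuple nat), E f v = eval f v t) -> recS n E.
Proof. by move=> Et; apply: recursive_ext (evalP n t) => f v; rewrite Et. Qed.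

Lemma rec1_term t g : (forall f x, g f x = eval f [:: x] t) -> rec1 g.
Proof. by move=> gt; apply: (@recS_term _ t) => f -[[|x []]] //= _; rewrite gt. Qed.

Lemma rec2_term t g : (forall f x y, g f x y = eval f [:: x; y] t) -> rec2 g.
Proof. by move=> gt; apply: (@recS_term _ t) => f -[[|x [|y []]]] //= _; rewrite gt. Qed.

Lemma recS_prec n (E G H : oracle -> seq nat -> nat) :
    recS n G -> recS n.+2 H ->
    (forall f (v : n.-tuple nat), E f (0 :: v) = G f v) ->
    (forall f k (v : n.-tuple nat), E f (k.+1 :: v) = H f [:: k, E f (k :: v) & v]) ->
  recS n.+1 E.
Proof.
move=> rG rH E0 ES; apply: recursive_ext (recf_prec rG rH) => f v.
case/tupleP: v => k v /=; rewrite theadE.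
by elim: k => [|k IHk] /=; rewrite ?E0 // IHk ES.
Qed.

(** In [t], [Var 0] is the counter and [Var 1] the previous value; [rec2_prec] adds the parameter as
    [Var 2]. *)
Lemma rec1_prec (c : nat) (t : term) (g : oracle -> nat -> nat) :
    recS 0 (fun _ _ => c) -> (forall f, g f 0 = c) ->
    (forall f k, g f k.+1 = eval f [:: k; g f k] t) ->
  rec1 g.
Proof.
move=> rc g0 gS.
apply: (recS_prec rc (evalP 2 t)) => [f v | f k v] /=; first exact: g0.
by rewrite gS; case: v => -[].
Qed.

Lemma rec2_prec (t0 t : term) (g : oracle -> nat -> nat -> nat) :
    (forall f x, g f 0 x = eval f [:: x] t0) ->
    (forall f k x, g f k.+1 x = eval f [:: k; g f k x; x] t) ->
  rec2 g.
Proof.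
move=> g0 gS.
by apply: (recS_prec (evalP 1 t0) (evalP 3 t)) => [f | f k] -[[|x []]] //= _;
  rewrite ?g0 ?gS.
Qed.

(** The value of [E] itself witnesses the regularity that [recf_min] demands. *)
Lemma recS_min n (E G : oracle -> seq nat -> nat) :
    recS n.+1 G ->
    (forall f (v : n.-tuple nat), G f (E f v :: v) = 0) ->
    (forall f (v : n.-tuple nat) m, G f (m :: v) = 0 -> E f v <= m) ->
  recS n E.
Proof.
move=> rG GE Emin.
have reg f (v : n.-tuple nat) : exists m, G f (m :: v) == 0.
  by exists (E f v); rewrite GE.
apply: recursive_ext (recf_min reg rG) => f v.
case: ex_minnP => m /eqP /Emin Em /(_ (E f v)); rewrite GE eqxx => /(_ isT) mE.
by apply/eqP; rewrite eqn_leq mE Em.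
Qed.

(** * Elementary recursive functions *)

Lemma rec_succ : rec1 (fun _ => S).
Proof. by apply: recursive_ext recf_succ => f [[|x []]]. Qed.

Lemma rec_ask : rec1 (fun f x => nat_of_bool (f x)).
Proof. by apply: recursive_ext recf_oracle => f [[|x []]]. Qed.

Lemma recS_zero : recS 0 (fun _ _ => 0).
Proof. exact: recf_zero. Qed.

Lemma rec_cst c : rec1 (fun _ _ => c).
Proof.
elim: c => [|c IHc].
  by apply: (@rec1_prec 0 (Var 1) _ recS_zero) => // f k.
exact: (@rec1_term (Ap1 rec_succ (Ap1 IHc (Var 0)))).
Qed.

Definition Cst c := Ap1 (rec_cst c) (Var 0).

Lemma recS_cst n c : recS n (fun _ _ => c).
Proof. exact: (evalP n (Cst c)). Qed.

Definition Succ t := Ap1 rec_succ t.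
Definition Query t := Ap1 rec_ask t.

Lemma rec_add : rec2 (fun _ => addn).
Proof. by apply: (@rec2_prec (Var 0) (Succ (Var 1))). Qed.
Definition Add t u := Ap2 rec_add t u.

Lemma rec_mul : rec2 (fun _ => muln).
Proof. by apply: (@rec2_prec (Cst 0) (Add (Var 2) (Var 1))). Qed.
Definition Mul t u := Ap2 rec_mul t u.

Lemma rec_pred : rec1 (fun _ => predn).
Proof. by apply: (@rec1_prec 0 (Var 0)) => //; apply: recS_cst. Qed.
Definition Pred t := Ap1 rec_pred t.

Lemma rec_sub : rec2 (fun _ => subn).
Proof.
(* Recursion runs on the first argument, so the subtrahend has to come first. *)
have r : rec2 (fun _ x y => y - x).
  by apply: (@rec2_prec (Var 0) (Pred (Var 1))) => f *; rewrite ?subn0 ?subnS.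
by apply: (@rec2_term (Ap2 r (Var 1) (Var 0))).
Qed.
Definition Sub t u := Ap2 rec_sub t u.

Lemma rec_not : rec1 (fun _ x => x == 0).
Proof. by apply: (@rec1_prec 1 (Cst 0)) => //; apply: recS_cst. Qed.
Definition Bnot t := Ap1 rec_not t.

Lemma rec_eq : rec2 (fun _ x y => x == y).
Proof.
apply: (@rec2_term (Bnot (Add (Sub (Var 0) (Var 1)) (Sub (Var 1) (Var 0))))).
by move=> f x y /=; rewrite addn_eq0 !subn_eq0 -eqn_leq.
Qed.
Definition Beq t u := Ap2 rec_eq t u.

Lemma rec_odd : rec1 (fun _ x => odd x).
Proof.
by apply: (@rec1_prec 0 (Bnot (Var 1))) => [||f k] //=; [apply: recS_cst | case: odd].
Qed.
Definition Odd t := Ap1 rec_odd t.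

Lemma rec_half : rec1 (fun _ => half).
Proof.
apply: (@rec1_prec 0 (Add (Odd (Var 0)) (Var 1))) => [||f k] //=; first exact: recS_cst.
by rewrite uphalf_half.
Qed.
Definition Half t := Ap1 rec_half t.

Lemma rec_pow2 : rec1 (fun _ x => 2 ^ x).
Proof.
apply: (@rec1_prec 1 (Add (Var 1) (Var 1))) => [||f k] //=; first exact: recS_cst.
by rewrite expnS mul2n addnn.
Qed.
Definition Pow2 t := Ap1 rec_pow2 t.

(** * Coding of sequences by numbers *)

Definition ccons (a b : nat) := 2 ^ a * b.*2.+1.

Lemma rec_cons : rec2 (fun _ => ccons).
Proof.
apply: (@rec2_term (Mul (Pow2 (Var 0)) (Succ (Add (Var 1) (Var 1))))) => f x y /=.
by rewrite addnn.
Qed.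
Definition Cons t u := Ap2 rec_cons t u.

(** Lists are coded by iterating [ccons] from 0, the code of the empty list. Pickles of pairs,
    tuples and lists are such codes, so recursive head and tail functions can take an instance
    apart. *)
Lemma codeE a s : CodeSeq.code (a :: s) = ccons a (CodeSeq.code s).
Proof. by []. Qed.

Lemma ccons_neq0 a b : ccons a b != 0.
Proof. by rewrite muln_eq0 expn_eq0. Qed.

Lemma cconsP N : N != 0 -> exists a b, N = ccons a b.
Proof.
rewrite -[N]CodeSeq.decodeK; case: (CodeSeq.decode N) => // a s _.
by exists a, (CodeSeq.code s).
Qed.

Definition halves (k N : nat) := iter k half N.

Lemma rec_halves : rec2 (fun _ => halves).
Proof. by apply: (@rec2_prec (Var 0) (Half (Var 1))). Qed.

Lemma halves_ccons k a b : k <= a -> halves k (ccons a b) = ccons (a - k) b.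
Proof.
elim: k => [|k IHk] ka; first by rewrite subn0.
rewrite /halves iterS -/(halves k _) IHk ?(ltnW ka) // -(subnSK ka).
by rewrite /ccons expnS -mulnA mul2n doubleK.
Qed.

Definition chd (N : nat) := head 0 (CodeSeq.decode N).
Definition ctl (N : nat) := CodeSeq.code (behead (CodeSeq.decode N)).

Lemma ccons_code a b : ccons a b = CodeSeq.code (a :: CodeSeq.decode b).
Proof. by rewrite codeE CodeSeq.decodeK. Qed.

Lemma chd_ccons a b : chd (ccons a b) = a.
Proof. by rewrite /chd ccons_code CodeSeq.codeK. Qed.

Lemma ctl_ccons a b : ctl (ccons a b) = b.
Proof. by rewrite /ctl ccons_code CodeSeq.codeK /= CodeSeq.decodeK. Qed.

Lemma chd_code s : chd (CodeSeq.code s) = head 0 s.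
Proof. by rewrite /chd CodeSeq.codeK. Qed.

Lemma ctl_code s : ctl (CodeSeq.code s) = CodeSeq.code (behead s).
Proof. by rewrite /ctl CodeSeq.codeK. Qed.

Lemma odd_ccons a b : odd (ccons a b) = (a == 0).
Proof. by rewrite oddM oddX /= odd_double andbT orbF. Qed.

Lemma rec_chd : rec1 (fun _ => chd).
Proof.
(* The head of [ccons a b] is the exponent of 2 in it: the least [m] for which [halves m N] is odd.
   The factor [Var 1] stops the search at once when [N] is 0. *)
pose T := Mul (Bnot (Odd (Ap2 rec_halves (Var 0) (Var 1)))) (Var 1).
apply: (recS_min (evalP 2 T)) => [f [[|N []]] //= _ | f [[|N []]] //= _ m].
  have [-> | /cconsP [a [b ->]]] := eqVneq N 0; first by rewrite muln0.
  by rewrite chd_ccons halves_ccons // subnn odd_ccons.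
have [-> // | /cconsP [a [b ->]]] := eqVneq N 0.
rewrite chd_ccons leqNgt; case: ltnP => // ma.
rewrite halves_ccons ?(ltnW ma) // odd_ccons subn_eq0 leqNgt ma /= mul1n => /eqP.
by rewrite (negPf (ccons_neq0 _ _)).
Qed.
Definition Hd t := Ap1 rec_chd t.

(** Dividing [ccons a b] by [2 ^ a] leaves the odd number [b.*2.+1], whose half is [b]. *)
Lemma rec_ctl : rec1 (fun _ => ctl).
Proof.
apply: (@rec1_term (Half (Ap2 rec_halves (Hd (Var 0)) (Var 0)))) => f N /=.
have [-> // | /cconsP [a [b ->]]] := eqVneq N 0; last first.
by rewrite ctl_ccons chd_ccons halves_ccons // subnn /ccons mul1n /= uphalf_double.
Qed.
Definition Tl t := Ap1 rec_ctl t.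

Definition cdrop (j N : nat) := iter j ctl N.

Lemma rec_cdrop : rec2 (fun _ => cdrop).
Proof. by apply: (@rec2_prec (Var 0) (Tl (Var 1))). Qed.
Definition Drop t u := Ap2 rec_cdrop t u.

Lemma cdrop_code j s : cdrop j (CodeSeq.code s) = CodeSeq.code (drop j s).
Proof.
elim: j => [|j IHj]; first by rewrite drop0.
by rewrite /cdrop iterS -/(cdrop _ _) IHj ctl_code -drop1 drop_drop.
Qed.

(** * Closure properties of arithmetical relations *)

Lemma recf_comp1 n g (F : functional n) :
  rec1 g -> recursive F -> recursive (fun f v => g f (F f v)).
Proof.
move=> rg rF; apply: recursive_ext (recf_comp rg (fun=> rF)) => f v.
by congr (g f _); rewrite -(tnth_nth 0 _ ord0) tnth_mktuple.
Qed.

Lemma recf_comp2 n g (F G : functional n) :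
  rec2 g -> recursive F -> recursive G -> recursive (fun f v => g f (F f v) (G f v)).
Proof.
move=> rg rF rG; pose H (i : 'I_2) := if val i == 0 then F else G.
have rH i : recursive (H i) by rewrite /H; case: ifP.
apply: recursive_ext (recf_comp rg rH) => f v.
congr (g f _ _); first by rewrite -(tnth_nth 0 _ ord0) tnth_mktuple.
by rewrite -(tnth_nth 0 _ (@Ordinal 2 1 isT)) tnth_mktuple.
Qed.

Lemma recf_shift n (F : functional n) :
  recursive F -> recursive (fun f (v : n.+1.-tuple nat) => F f [tuple of behead v]).
Proof.
move=> rF; apply: recursive_ext (recf_comp rF (fun i => recf_proj (lift ord0 i))) => f v.
case/tupleP: v => m v; congr (F f _).
by apply: eq_from_tnth => i; rewrite tnth_mktuple tnthS !(tnth_nth 0).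
Qed.

Lemma arithmetical_not n (R : oracle -> n.-tuple nat -> Prop) :
  arithmetical R -> arithmetical (fun f v => ~ R f v).
Proof.
elim=> {n R} [n F rF | n R _ IH | n R _ IH].
- have r1 : rec1 (fun _ x => x != 1).
    apply: (@rec1_term (Bnot (Beq (Var 0) (Cst 1)))) => f x /=.
    by rewrite eqb0.
  apply: arithmetical_ext (arith_rec (recf_comp1 r1 rF)) => f v.
  by case: eqP.
- apply: arithmetical_ext (arith_all IH) => f v.
  by split=> [H [m Rm] | H m Rm]; [exact: (H m) | apply: H; exists m].
- apply: arithmetical_ext (arith_ex IH) => f v.
  split=> [[m H] Rm | H]; first exact: H (Rm m).
  exact: not_all_ex_not H.
Qed.

Lemma arithmetical_rename n (R : oracle -> n.-tuple nat -> Prop) :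
    arithmetical R -> forall p (r : 'I_n -> 'I_p),
  arithmetical (fun f (v : p.-tuple nat) => R f [tuple tnth v (r i) | i < n]).
Proof.
(* [r'] is [r] carried under a quantifier: it fixes the bound variable, which comes first. *)
pose r' n p (r : 'I_n -> 'I_p) (i : 'I_n.+1) : 'I_p.+1 :=
  if unlift ord0 i is Some j then lift ord0 (r j) else ord0.
have r'E n' p (r : 'I_n' -> 'I_p) m (v : p.-tuple nat) :
    [tuple tnth [tuple of m :: v] (r' n' p r i) | i < n'.+1] =
    [tuple of m :: [tuple tnth v (r i) | i < n']].
  apply: eq_from_tnth => i; rewrite tnth_mktuple /r'.
  by case: unliftP => [j ->|->]; rewrite ?tnth0 // !tnthS tnth_mktuple.
elim=> {n R} [n F rF | n R _ IH | n R _ IH] p r.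
- exact: arith_rec (recf_comp rF (fun i => recf_proj (r i))).
- apply: arithmetical_ext (arith_ex (IH _ (r' _ _ r))) => f v.
  by split=> -[m]; exists m; rewrite ?r'E // -r'E.
- apply: arithmetical_ext (arith_all (IH _ (r' _ _ r))) => f v.
  by split=> H m; have := H m; rewrite r'E.
Qed.

Lemma arithmetical_shift n (R : oracle -> n.-tuple nat -> Prop) :
    arithmetical R ->
  arithmetical (fun f (v : n.+1.-tuple nat) => R f [tuple of behead v]).
Proof.
move=> aR; apply: arithmetical_ext (arithmetical_rename aR (lift ord0)) => f v.
case/tupleP: v => m v.
suff -> : [tuple tnth [tuple of m :: v] (lift ord0 i) | i < n] =
          [tuple of behead [tuple of m :: v]] by [].
by apply: eq_from_tnth => i; rewrite tnth_mktuple tnthS !(tnth_nth 0).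
Qed.

(** As [arithmetical] only has quantifier prefixes, the quantifiers of [R] are pulled out first and
    then, once [R] is recursive, those of [S]. For a universal quantifier, the instance 0 recovers
    the other conjunct. *)
Lemma arithmetical_and n (R S : oracle -> n.-tuple nat -> Prop) :
  arithmetical R -> arithmetical S -> arithmetical (fun f v => R f v /\ S f v).
Proof.
have bh p m (v : p.-tuple nat) : [tuple of behead [tuple of m :: v]] = v.
  by apply: val_inj.
have base p (F : functional p) T : recursive F -> arithmetical T ->
    arithmetical (fun f v => F f v = 1 /\ T f v).
  move=> rF aT; elim: aT F rF => {p T} [p G rG | p T _ IH | p T _ IH] F rF.
  - have r2 : rec2 (fun _ x y => (x == 1) * (y == 1)).
      exact: (@rec2_term (Mul (Beq (Var 0) (Cst 1)) (Beq (Var 1) (Cst 1)))).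
    apply: arithmetical_ext (arith_rec (recf_comp2 r2 rF rG)) => f v.
    by do 2!case: eqP => ? /=; split=> // -[].
  - apply: arithmetical_ext (arith_ex (IH _ (recf_shift rF))) => f v.
    split=> [[m] | [Fv [m Tm]]]; first by rewrite bh => -[? ?]; split=> //; exists m.
    by exists m; rewrite bh.
  - apply: arithmetical_ext (arith_all (IH _ (recf_shift rF))) => f v.
    split=> [H | [Fv H] m]; last by rewrite bh.
    by split=> [|m]; [have [] := H 0; rewrite bh | have [] := H m].
move=> aR; elim: aR S => {n R} [n F rF S | n R _ IH S aS | n R _ IH S aS].
- exact: base.
- apply: arithmetical_ext (arith_ex (IH _ (arithmetical_shift aS))) => f v.
  split=> [[m] | [[m Rm] Sv]]; first by rewrite bh => -[? ?]; split=> //; exists m.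
  by exists m; rewrite bh.
- apply: arithmetical_ext (arith_all (IH _ (arithmetical_shift aS))) => f v.
  split=> [H | [H Sv] m]; last by rewrite bh.
  by split=> [m|]; [have [] := H m | have [] := H 0; rewrite bh].
Qed.

(** * First-order formulas with an oracle *)

Inductive form : Type :=
| Eq of term & term
| Not of form
| And of form & form
| Imp of form & form
| All of form
| Ex of form.

Fixpoint holds (f : oracle) (s : seq nat) (p : form) : Prop :=
  match p with
  | Eq t u => eval f s t = eval f s u
  | Not p => ~ holds f s p
  | And p q => holds f s p /\ holds f s q
  | Imp p q => holds f s p -> holds f s q
  | All p => forall m, holds f (m :: s) p
  | Ex p => exists m, holds f (m :: s) p
  end.

(** Formulas nest connectives and quantifiers freely; the closure properties bring them into prenex
    form. Variables are de Bruijn indices, so a quantifier puts its value in front of the tuple, as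
    [arith_ex] and [arith_all] do. *)
Lemma holdsP n p : arithmetical (fun f (v : n.-tuple nat) => holds f v p).
Proof.
elim: p n => [t u|p IH|p IHp q IHq|p IHp q IHq|p IH|p IH] n /=.
- apply: arithmetical_ext (arith_rec (evalP n (Beq t u))) => f v /=.
  by case: eqP.
- exact: arithmetical_not (IH n).
- exact: arithmetical_and (IHp n) (IHq n).
- apply: arithmetical_ext
    (arithmetical_not (arithmetical_and (IHp n) (arithmetical_not (IHq n)))) => f v.
  by split=> [H Hp | H [/H]] //; apply: NNPP => Hq; apply: H.
- exact: arith_all (IH n.+1).
- exact: arith_ex (IH n.+1).
Qed.

Lemma Sigma11_form (P : nat -> Prop) (p : form) :
  (forall n, P n <-> exists f, holds f [:: n] p) -> Sigma11 P.
Proof.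
by move=> Pp; exists (fun f v => holds f v p); split; first exact: holdsP.
Qed.

(** * The aperiodic domino problem is Sigma^1_1 *)

Fixpoint up (t : term) : term :=
  match t with
  | Var i => Var i.+1
  | Ap1 g rg t => Ap1 rg (up t)
  | Ap2 g rg t u => Ap2 rg (up t) (up u)
  end.

Lemma eval_up f m s t : eval f (m :: s) (up t) = eval f s t.
Proof. by elim: t => //= [g rg t -> | g rg t -> u ->]. Qed.

(** An integer is pickled as a list of two numbers: [[:: 2 ^ m; 0]] for [Posz m] and [[:: 0; 2 ^ m]]
    for [Negz m], where [2 ^ m] codes [[:: m]]. As [Negz m] is -(m + 1), [ineg] adds 1 when the
    second entry is nonzero. *)
Definition ipos c := chd (chd c).
Definition ineg c := (chd (ctl c) != 0) + chd (chd (ctl c)).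
Definition is_int c : bool :=
  (c == ccons (2 ^ ipos c) (ccons 0 0)) ||
  (c == ccons 0 (ccons (2 ^ chd (chd (ctl c))) 0)).

Lemma rec_ipos : rec1 (fun _ => ipos).
Proof. exact: (@rec1_term (Hd (Hd (Var 0)))). Qed.

Lemma rec_ineg : rec1 (fun _ => ineg).
Proof.
apply: (@rec1_term (Add (Bnot (Bnot (Hd (Tl (Var 0))))) (Hd (Hd (Tl (Var 0)))))).
by move=> f x /=; rewrite eqb0.
Qed.

Lemma rec_is_int : rec1 (fun _ c => is_int c).
Proof.
pose t1 := Beq (Var 0) (Cons (Pow2 (Ap1 rec_ipos (Var 0))) (Cst (ccons 0 0))).
pose t2 := Beq (Var 0) (Cons (Cst 0) (Cons (Pow2 (Hd (Hd (Tl (Var 0))))) (Cst 0))).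
apply: (@rec1_term (Bnot (Bnot (Add t1 t2)))) => f x.
by rewrite /= eqb0 addn_eq0 !eqb0 negb_and !negbK.
Qed.

Lemma code1 m : CodeSeq.code [:: m] = 2 ^ m.
Proof. by rewrite /= muln1. Qed.

Lemma pickle_Posz (m : nat) : pickle (Posz m) = ccons (2 ^ m) (ccons 0 0).
Proof. by rewrite -code1. Qed.

Lemma pickle_Negz (m : nat) : pickle (Negz m) = ccons 0 (ccons (2 ^ m) 0).
Proof. by rewrite -code1. Qed.

Lemma pow2E m : 2 ^ m = ccons m 0.
Proof. by rewrite /ccons muln1. Qed.

Lemma pickle_intE z : z = (Posz (ipos (pickle z)) - Posz (ineg (pickle z)))%R.
Proof.
rewrite /ipos /ineg; case: z => m.
  by rewrite pickle_Posz ctl_ccons !chd_ccons pow2E chd_ccons subr0.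
rewrite pickle_Negz ctl_ccons !chd_ccons pow2E chd_ccons.
by rewrite (negPf (ccons_neq0 _ _)) NegzE add1n sub0r.
Qed.

(** The equation is arranged without subtraction, which would be truncated on natural numbers. *)
Lemma pickle_intD (x y z : int) :
  ipos (pickle x) + ipos (pickle y) + ineg (pickle z) =
    ineg (pickle x) + ineg (pickle y) + ipos (pickle z) <-> z = (x + y)%R.
Proof.
have := (pickle_intE x, pickle_intE y, pickle_intE z).
move: (ipos _) (ipos _) (ipos _) (ineg _) (ineg _) (ineg _) => a b c a' b' c'.
by case=> [[-> ->] ->]; split; lia.
Qed.

Lemma is_intP c : reflect (exists z : int, c = pickle z) (is_int c).
Proof.
apply: (iffP orP) => [[] /eqP cE | [[m|m] ->]].
- by exists (Posz (ipos c)); rewrite pickle_Posz.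
- by exists (Negz (chd (chd (ctl c)))); rewrite pickle_Negz.
- by left; rewrite /ipos pickle_Posz chd_ccons [in chd _]pow2E chd_ccons.
- by right; rewrite pickle_Negz ctl_ccons chd_ccons [in chd _]pow2E chd_ccons.
Qed.

Lemma code_eq0 s : (CodeSeq.code s == 0) = nilp s.
Proof. by case: s => //= a s; rewrite muln_eq0 expn_eq0. Qed.

Lemma cdrop_eq0 j N : (cdrop j N == 0) = (size (CodeSeq.decode N) <= j).
Proof. by rewrite -[N in LHS]CodeSeq.decodeK cdrop_code code_eq0 /nilp size_drop subn_eq0. Qed.

Lemma chd_cdrop j N : chd (cdrop j N) = nth 0 (CodeSeq.decode N) j.
Proof.
by rewrite -[N in LHS]CodeSeq.decodeK cdrop_code chd_code -nth0 nth_drop addn0.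
Qed.

(** Every number codes a list, and only the empty list has code 0; so [cdrop j N != 0] says that the
    list has an entry of index [j]. *)
Lemma all_pickle (T : countType) N :
  (forall j, cdrop j N != 0 -> exists t : T, chd (cdrop j N) = pickle t) <->
  (exists s : seq T, N = pickle s).
Proof.
split=> [H | [s ->] j]; last first.
  rewrite cdrop_eq0 chd_cdrop [pickle s]/(CodeSeq.code (map pickle s)) CodeSeq.codeK.
  rewrite size_map -ltnNge.
  case: s => // t s js; exists (nth t (t :: s) j).
  by rewrite (nth_map t).
suff [s sN] : exists s : seq T, CodeSeq.decode N = map pickle s.
  by exists s; rewrite -[N]CodeSeq.decodeK sN.
have {}H x : x \in CodeSeq.decode N -> exists t : T, x = pickle t.
  move=> xN; have := H (index x (CodeSeq.decode N)).
  by rewrite cdrop_eq0 chd_cdrop nth_index // -ltnNge index_mem => /(_ xN).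
elim: (CodeSeq.decode N) H => [|x s IHs] H; first by exists [::].
have [|l ->] := IHs; first by move=> y ys; apply: H; rewrite inE ys orbT.
by have [t ->] := H x (mem_head _ _); exists (t :: l).
Qed.

Lemma onth_find (T : Type) (P : pred T) s t :
    onth s (find P s) = Some t ->
  P t /\ forall e u, e < find P s -> onth s e = Some u -> ~~ P u.
Proof.
elim: s => //= a s IHs; case: ifP => [Pa [<-] | Pa Es]; first by split.
have [Pt H] := IHs Es; split=> // -[|e] u /=; first by move=> _ [<-]; rewrite Pa.
exact: H.
Qed.

Lemma find_onth (T : Type) (P : pred T) s e t :
    onth s e = Some t -> P t ->
    (forall e' u, e' < e -> onth s e' = Some u -> ~~ P u) ->
  find P s = e.
Proof.
elim: s e => [|a s IHs] [|e] //=; first by move=> [->] ->.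
move=> Ee Pt H.
rewrite (negPf (H 0 a _ _)) //; congr _.+1; apply: IHs Ee Pt _ => e' u lt_e.
exact: (H e'.+1).
Qed.

Section Membership.

Variable d : nat.
Notation pos := (d.-tuple int).

Definition rowt (t : pos) : Zd d := (\row_(i < d) tnth t i)%R.
Definition tupr (i : Zd d) : pos := [tuple i ord0 j | j < d].

Lemma tuprK : cancel tupr rowt.
Proof. by move=> i; apply/rowP => j; rewrite mxE tnth_mktuple. Qed.

Lemma rowtK : cancel rowt tupr.
Proof. by move=> t; apply: eq_from_tnth => j; rewrite tnth_mktuple mxE. Qed.

(** Atomic formulas are equations, so [j < d] is expressed by [d - j <> 0], here and below. *)
Definition fPos (p : term) : form :=
  And (Eq (Drop (Cst d) p) (Cst 0))
    (All (Imp (Not (Eq (Sub (Cst d) (Var 0)) (Cst 0)))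
      (And (Not (Eq (Drop (Var 0) (up p)) (Cst 0)))
           (Eq (Ap1 rec_is_int (Hd (Drop (Var 0) (up p)))) (Cst 1))))).

Lemma fPosP f s p : holds f s (fPos p) <-> exists t : pos, eval f s p = pickle t.
Proof.
rewrite /= ; set N := eval f s p; split=> [[/eqP N0 H] | [t tE]].
  have szN : size (CodeSeq.decode N) = d.
    apply/eqP; rewrite eqn_leq -cdrop_eq0 N0 leqNgt; apply/negP => lt_d.
    have := H (size (CodeSeq.decode N)); rewrite eval_up => -[].
      by apply/eqP; rewrite subn_eq0 -ltnNge.
    by move/eqP; rewrite cdrop_eq0 leqnn.
  have /all_pickle [l lE] : forall j, cdrop j N != 0 ->
      exists z : int, chd (cdrop j N) = pickle z.
    move=> j; rewrite cdrop_eq0 szN -ltnNge => jd.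
    have := H j; rewrite eval_up => -[|_ /eqP].
      by apply/eqP; rewrite subn_eq0 -ltnNge.
    by rewrite eqb1 => /is_intP.
  have szl : size l == d by rewrite -szN lE CodeSeq.codeK size_map.
  by exists (Tuple szl).
have dE : CodeSeq.decode N = map pickle t by rewrite tE CodeSeq.codeK.
split=> [|j jd]; first by apply/eqP; rewrite cdrop_eq0 dE size_map size_tuple.
have {}jd : j < d by rewrite ltnNge -subn_eq0; apply/eqP.
rewrite eval_up -/N; split; first by apply/eqP; rewrite cdrop_eq0 dE size_map size_tuple -ltnNge.
apply/eqP; rewrite eqb1; apply/is_intP; rewrite chd_cdrop dE.
by exists (tnth t (Ordinal jd)); rewrite (nth_map 0%R) ?size_tuple // (tnth_nth 0%R).
Qed.

Definition fAdd (p q r : term) : form :=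
  let at_ u := Hd (Drop (Var 0) (up u)) in
  let ip u := Ap1 rec_ipos (at_ u) in let im u := Ap1 rec_ineg (at_ u) in
  All (Imp (Not (Eq (Sub (Cst d) (Var 0)) (Cst 0)))
    (Eq (Add (Add (ip p) (ip q)) (im r)) (Add (Add (im p) (im q)) (ip r)))).

Lemma fAddP f s p q r (t u v : pos) :
    eval f s p = pickle t -> eval f s q = pickle u -> eval f s r = pickle v ->
  holds f s (fAdd p q r) <-> rowt v = (rowt t + rowt u)%R.
Proof.
move=> pt qu rv.
have nthE (w : pos) (j : 'I_d) : chd (cdrop j (pickle w)) = pickle (tnth w j).
  rewrite chd_cdrop [pickle w]/(CodeSeq.code (map pickle w)) CodeSeq.codeK.
  by rewrite (nth_map 0%R) ?size_tuple // (tnth_nth 0%R).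
split=> /= [H | vE j jd].
  apply/rowP => j; rewrite !mxE.
  have := H j; rewrite !eval_up pt qu rv !nthE.
  by move/(_ _)/pickle_intD; apply; apply/eqP; rewrite subn_eq0 -ltnNge.
have {}jd : j < d by rewrite ltnNge -subn_eq0; apply/eqP.
rewrite !eval_up pt qu rv -[j]/(val (Ordinal jd)) !nthE; apply/pickle_intD.
by have /rowP /(_ (Ordinal jd)) := vE; rewrite !mxE.
Qed.

Local Open Scope fmap_scope.

Lemma fnd_pattern_of k (s : seq (pos * 'I_k)) p :
  (pattern_of s).[? rowt p] =
    omap snd (onth s (find (fun ja => ja.1 == p) s)).
Proof.
elim: s => [|[q a] s IHs] /=; first by rewrite fnd_fmap0.
rewrite fnd_set -/(rowt q) (can_eq rowtK) eq_sym.
by case: ifP => //= _; rewrite IHs.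
Qed.

Lemma appears_fnd k (w : pattern d 'I_k) x :
  appears w x <-> exists i, forall j a, w.[? j] = Some a -> x (i + j)%R = a.
Proof.
split=> -[i H]; exists i.
  by move=> j a /fndSomeP [jw <-]; apply: H.
by move=> j jw; apply: H; rewrite in_fnd.
Qed.

(** In [pattern_of] the first entry for a position wins, so a mismatch counts only at an entry whose
    position is not listed earlier. *)
Lemma not_appears_pattern_of k (s : seq (pos * 'I_k)) x :
  ~ appears (pattern_of s) x <->
  forall i, exists e q a, [/\ onth s e = Some (q, a),
    forall e' q' a', e' < e -> onth s e' = Some (q', a') -> q' <> q &
    x (i + rowt q)%R <> a].
Proof.
rewrite appears_fnd; split=> [H i | H [i Hi]].
  apply: NNPP => nH; apply: H; exists i => j a; rewrite -[j]tuprK fnd_pattern_of.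
  case E: (onth _ _) => [[q' a']|] //= [<-] {a}.
  have [/= /eqP q'E H] := onth_find E; rewrite {}q'E in E *.
  apply: NNPP => ne; apply: nH; exists (find (fun ja => ja.1 == tupr j) s), (tupr j), a'.
  by split=> // e' q1 a1 /H /[apply] /eqP.
have [e [q [a [E first_e]]]] := H i; apply; apply: Hi.
rewrite fnd_pattern_of (@find_onth _ _ s e (q, a)) ?E //= => e' [q' a'] lte.
by move/(first_e _ _ _ lte)/eqP.
Qed.

Lemma cdrop_pickle (T : countType) (s : seq T) j :
  cdrop j (pickle s) <> 0 <-> exists t, onth s j = Some t.
Proof.
rewrite [pickle s]/(CodeSeq.code (map pickle s)).
have E : (cdrop j (CodeSeq.code (map pickle s)) == 0) = ~~ onth s j.
  by rewrite cdrop_eq0 CodeSeq.codeK size_map onthNE.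
split=> [/eqP | [t st]]; last by apply/eqP; rewrite E st.
by rewrite E; case: onth => // t _; exists t.
Qed.

Lemma chd_cdrop_pickle (T : countType) (s : seq T) j t :
  onth s j = Some t -> chd (cdrop j (pickle s)) = pickle t.
Proof.
move=> E; rewrite chd_cdrop [pickle s]/(CodeSeq.code (map pickle s)) CodeSeq.codeK.
by apply: onth_nth; rewrite onth_map E.
Qed.

(** The oracle is the graph of [x]: a query contains both a position and a symbol, which keeps the
    coding uniform in the size of the alphabet. *)
Definition codes k (f : oracle) (x : config d 'I_k) :=
  forall (t : pos) b, f (ccons (pickle t) b) = (val (x (rowt t)) == b).

Lemma codes_ex k (x : config d 'I_k) : exists f, codes f x.
Proof.
exists (fun c => if choice.unpickle (chd c) is Some t then val (x (rowt t)) == ctl c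
                 else false) => t b.
by rewrite chd_ccons ctl_ccons choice.pickleK.
Qed.

Definition fConf (k : term) : form :=
  All (Imp (fPos (Var 0))
    (Ex (And (Not (Eq (Sub (up (up k)) (Var 0)) (Cst 0)))
      (All (Eq (Query (Cons (Var 2) (Var 0))) (Beq (Var 1) (Var 0))))))).

Lemma fConfP f s k kt : eval f s kt = k ->
  holds f s (fConf kt) <-> exists x : config d 'I_k, codes f x.
Proof.
move=> kE; split=> [H | [x fx] m /fPosP /= [t ->]]; last first.
  exists (x (rowt t)); rewrite !eval_up kE; split=> [|b]; last by rewrite fx.
  by apply/eqP; rewrite subn_eq0 -ltnNge.
have {}H (t : pos) : exists a : 'I_k, forall b, f (ccons (pickle t) b) = (val a == b).
  have [|a] := H (pickle t); first by apply/fPosP; exists t.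
  rewrite /= !eval_up kE => -[/eqP]; rewrite subn_eq0 -ltnNge => ak fE.
  by exists (Ordinal ak) => b /=; move: (fE b); case: (f _); case: (a == b).
have H' (t : pos) : exists a : 'I_k, f (ccons (pickle t) a).
  by have [a fa] := H t; exists a; rewrite fa.
exists (fun i => xchoose (H' (tupr i))) => t b; rewrite rowtK.
have := xchooseP (H' t); move: (xchoose _) => c.
by have [a fa] := H t; rewrite !fa => /eqP/val_inj ->.
Qed.

(** From the outside in, the bound variables are the index of a pattern, the index of an entry in
    it, the position of that entry and its symbol. *)
Definition fWf (k L : term) : form :=
  All (Imp (Not (Eq (Drop (Var 0) (up L)) (Cst 0)))
  (All (Imp (Not (Eq (Drop (Var 0) (Hd (Drop (Var 1) (up (up L))))) (Cst 0)))
  (Ex (Ex (And (fPos (Var 1))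
          (And (Not (Eq (Sub (up (up (up (up k)))) (Var 0)) (Cst 0)))
               (Eq (Hd (Drop (Var 2) (up (up (Hd (Drop (Var 1) (up (up L))))))))
                   (Cons (Var 1) (Cons (Var 0) (Cst 0))))))))))).

Lemma pickle_entry k (q : pos) (a : 'I_k) :
  pickle (q, a) = ccons (pickle q) (ccons a 0).
Proof. by []. Qed.

Lemma fWfP f s k kt Lt : eval f s kt = k ->
  holds f s (fWf kt Lt) <->
  exists l : seq (seq (pos * 'I_k)), eval f s Lt = pickle l.
Proof.
move=> kE; rewrite -all_pickle.
suff H j : holds f (j :: s)
  (All (Imp (Not (Eq (Drop (Var 0) (Hd (Drop (Var 1) (up (up Lt))))) (Cst 0)))
  (Ex (Ex (And (fPos (Var 1))
          (And (Not (Eq (Sub (up (up (up (up kt)))) (Var 0)) (Cst 0)))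
               (Eq (Hd (Drop (Var 2) (up (up (Hd (Drop (Var 1) (up (up Lt))))))))
                   (Cons (Var 1) (Cons (Var 0) (Cst 0)))))))))) <->
    exists l : seq (pos * 'I_k), chd (cdrop j (eval f s Lt)) = pickle l.
  split=> [W j Lj | W j Lj].
    by apply/H; refine (W j _); rewrite /= eval_up; apply/eqP.
  by apply/H; apply: W; apply/eqP; move: Lj; rewrite /= eval_up.
rewrite -all_pickle.
split=> [W e we | W e /=].
  have [|q [a []]] := W e; first by rewrite /= !eval_up; apply/eqP.
  move=> /(iffLR (fPosP f [:: a, q, e, j & s] (Var 1))) [t qt].
  rewrite /= !eval_up kE => -[/eqP ak].
  rewrite subn_eq0 -ltnNge in ak => ->.
  by exists (t, Ordinal ak); rewrite pickle_entry -[pickle t]qt.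
rewrite /= !eval_up => /eqP /W [[t a] tE]; exists (pickle t), a; split.
  by apply: (iffRL (fPosP f [:: val a, pickle t, e, j & s] (Var 1))); exists t.
rewrite !eval_up kE; split; last by rewrite tE pickle_entry.
by apply/eqP; rewrite subn_eq0 -ltnNge.
Qed.

(** This is the criterion of [not_appears_pattern_of]. The bound variables are the index of a
    pattern, the translation, the index of the mismatching entry and, after the clause on earlier
    entries, the position at which the oracle is queried. *)
Definition fSFT (L : term) : form :=
  All (Imp (Not (Eq (Drop (Var 0) (up L)) (Cst 0)))
    (All (Imp (fPos (Var 0))
      (let w := Hd (Drop (Var 2) (up (up (up L)))) in
       Ex (And (Not (Eq (Drop (Var 0) w) (Cst 0)))
            (And (All (Imp (Not (Eq (Sub (Var 1) (Var 0)) (Cst 0)))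
                        (Imp (Not (Eq (Drop (Var 0) (up w)) (Cst 0)))
                          (Not (Eq (Hd (Hd (Drop (Var 0) (up w))))
                                   (Hd (Hd (Drop (Var 1) (up w)))))))))
              (Ex (And (fPos (Var 0))
                (And (fAdd (Var 2) (Hd (Hd (Drop (Var 1) (up w)))) (Var 0))
                  (Eq (Query (Cons (Var 0) (Hd (Tl (Hd (Drop (Var 1) (up w)))))))
                      (Cst 0))))))))))).

Lemma fSFTP f s k (l : seq (seq (pos * 'I_k))) (x : config d 'I_k) Lt :
    eval f s Lt = pickle l -> codes f x ->
  holds f s (fSFT Lt) <-> forall w, w \in map (@pattern_of d k) l -> ~ appears w x.
Proof.
move=> lE fx.
suff H j p t : onth l j = Some p ->
  holds f [:: pickle (t : pos), j & s]
    (let w := Hd (Drop (Var 2) (up (up (up Lt)))) in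
     Ex (And (Not (Eq (Drop (Var 0) w) (Cst 0)))
            (And (All (Imp (Not (Eq (Sub (Var 1) (Var 0)) (Cst 0)))
                        (Imp (Not (Eq (Drop (Var 0) (up w)) (Cst 0)))
                          (Not (Eq (Hd (Hd (Drop (Var 0) (up w))))
                                   (Hd (Hd (Drop (Var 1) (up w)))))))))
              (Ex (And (fPos (Var 0))
                (And (fAdd (Var 2) (Hd (Hd (Drop (Var 1) (up w)))) (Var 0))
                  (Eq (Query (Cons (Var 0) (Hd (Tl (Hd (Drop (Var 1) (up w)))))))
                      (Cst 0)))))))) <->
  exists e q a, [/\ onth p e = Some (q, a),
    forall e' q' a', e' < e -> onth p e' = Some (q', a') -> q' <> q &
    x (rowt t + rowt q)%R <> a].
  split=> [S w /mapP [p /onthP [j pj] ->] | S j lj m /(iffLR (fPosP f _ (Var 0))) [t mt]].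
    apply/not_appears_pattern_of => i; rewrite -[i]tuprK; apply/(H j p (tupr i) pj).
    refine (S j _ _ _); last by apply: (iffRL (fPosP f _ (Var 0))); exists (tupr i).
    by rewrite /= eval_up lE cdrop_pickle; exists p.
  move: lj; rewrite /= eval_up lE cdrop_pickle => -[p pj].
  rewrite [m]mt; apply/(H j p t pj); move: (rowt t); apply/not_appears_pattern_of.
  by apply: S; apply/mapP; exists p => //; apply/onthP; exists j.
move=> pj.
have wE m1 : chd (cdrop j (eval f (m1 :: pickle t :: j :: s) (up (up (up Lt))))) = pickle p.
  by rewrite !eval_up lE; apply: chd_cdrop_pickle.
have wE2 m1 m2 :
    chd (cdrop j (eval f [:: m2, m1, pickle t, j & s] (up (up (up (up Lt)))))) = pickle p.
  by rewrite eval_up wE.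
have eE i q a : onth p i = Some (q, a) ->
    chd (chd (cdrop i (pickle p))) = pickle q /\
    chd (ctl (chd (cdrop i (pickle p)))) = a.
  by move/chd_cdrop_pickle => ->; rewrite pickle_entry ctl_ccons !chd_ccons.
split.
  case=> e [he [hf [r [hr [ha hq]]]]].
  have {he} /cdrop_pickle [[q a] pe] : cdrop e (pickle p) <> 0 by move: he; rewrite /= wE.
  have [cq ca] := eE e q a pe.
  have /fPosP [r' r'E] := hr : holds f [:: r, e, pickle t, j & s] (fPos (Var 0)).
  have {}ha : rowt r' = (rowt t + rowt q)%R.
    by apply: (iffLR (@fAddP f [:: r, e, pickle t, j & s] _ _ _ t q r' _ _ _) ha) => //=;
      rewrite wE2 cq.
  exists e, q, a; split=> // [e' q' a' lte pe' | xa].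
    have := hf e'; rewrite /= wE2 (eE e' q' a' pe').1 cq => /(_ _ _)/[swap] <- H.
    apply: H => //; first by apply/eqP; rewrite subn_eq0 -ltnNge.
    by apply/cdrop_pickle; exists (q', a').
  move: hq; rewrite /= wE2 ca [r]r'E fx ha xa eqxx.
  by [].
case=> e [q [a [pe first_e ne]]]; exists e.
have [cq ca] := eE e q a pe.
split; first by rewrite /= wE; apply/cdrop_pickle; exists (q, a).
split=> [e' lte |].
  rewrite /= wE2 => /cdrop_pickle [[q' a'] pe']; rewrite (eE e' q' a' pe').1 cq.
  move/(pcan_inj choice.pickleK); apply: first_e pe'.
  by move/eqP: lte; rewrite /= subn_eq0 -ltnNge.
exists (pickle (tupr (rowt t + rowt q)%R)); split.
  by apply: (iffRL (fPosP f [:: _, e, pickle t, j & s] (Var 0))); eexists.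
split.
  by apply: (iffRL (@fAddP f [:: _, e, pickle t, j & s] _ _ _ t q _ _ _ _));
    rewrite /= ?wE2 ?cq // tuprK.
rewrite /= wE2 ca fx tuprK.
by apply/eqP; rewrite eqb0; apply/eqP => /val_inj.
Qed.

Definition fAper : form :=
  All (Imp (fPos (Var 0)) (Imp (Not (Eq (Var 0) (Cst (pickle (tupr 0%R)))))
  (Ex (Ex (And (fPos (Var 1)) (And (fPos (Var 0)) (And (fAdd (Var 1) (Var 2) (Var 0))
    (Ex (And (Eq (Query (Cons (Var 1) (Var 0))) (Cst 1))
             (Eq (Query (Cons (Var 2) (Var 0))) (Cst 0))))))))))).

Lemma fAperP f s k (x : config d 'I_k) :
  codes f x -> holds f s fAper <-> aperiodic x.
Proof.
move=> fx; split=> [H p p0 | H m /(iffLR (fPosP f (m :: s) (Var 0))) [/= t ->] t0].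
  have [||i [r [hi [hr [ha [a]]]]]] := H (pickle (tupr p)).
  - by apply: (iffRL (fPosP f (pickle (tupr p) :: s) (Var 0))); exists (tupr p).
  - move/(pcan_inj choice.pickleK) => /= pE; apply: p0.
    by rewrite -[p]tuprK [tupr p]pE tuprK.
  have /fPosP [i' i'E] := hi : holds f [:: r, i, pickle (tupr p) & s] (fPos (Var 1)).
  have /fPosP [r' r'E] := hr : holds f [:: r, i, pickle (tupr p) & s] (fPos (Var 0)).
  have rE : rowt r' = (rowt i' + p)%R.
    rewrite -[p in RHS]tuprK.
    exact: (iffLR (@fAddP f [:: r, i, pickle (tupr p) & s] _ _ _ i' _ r' _ _ _) ha).
  rewrite /= [r]r'E [i]i'E !fx => -[xr xi]; exists (rowt i'); rewrite -rE => rE'.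
  by move: xr xi; rewrite rE'; case: eqP.
have [|i ne] := H (rowt t).
  by move=> t0'; apply: t0; rewrite -t0' rowtK.
pose r := tupr (i + rowt t)%R; pose e := [:: pickle r, pickle (tupr i), pickle t & s].
exists (pickle (tupr i)), (pickle r).
split; first by apply: (iffRL (fPosP f e (Var 1))); exists (tupr i).
split; first by apply: (iffRL (fPosP f e (Var 0))); exists r.
split.
  apply: (iffRL (@fAddP f e (Var 1) (Var 2) (Var 0) (tupr i) t r _ _ _)) => //.
  by rewrite !tuprK.
exists (x (i + rowt t)%R); rewrite /= !fx !tuprK eqxx; split=> //.
by apply/eqP; rewrite eqb0; apply/eqP => /val_inj xi; apply: ne.
Qed.

Definition fDomino : form :=
  Ex (Ex (And (Eq (Var 2) (Cons (Var 1) (Cons (Var 0) (Cst 0))))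
    (And (fWf (Var 1) (Var 0)) (And (fConf (Var 1)) (And (fSFT (Var 0)) fAper))))).

Lemma Sigma11_aperiodic_domino : Sigma11 (aperiodic_domino d).
Proof.
apply: (Sigma11_form (p := fDomino)) => n; split.
  case=> -[k l] [-> [x [xl xa]]]; have [f fx] := codes_ex x; exists f, k, (pickle l).
  pose e := [:: pickle l; k; pickle (Tagged (fun k => seq (seq (pos * 'I_k))) l)].
  split=> //; split; first by apply: (iffRL (@fWfP f e k (Var 1) (Var 0) erefl)); exists l.
  split; first by apply: (iffRL (@fConfP f e k (Var 1) erefl)); exists x.
  split; first exact: (iffRL (@fSFTP f e k l x (Var 0) erefl fx)).
  exact: (iffRL (@fAperP f e k x fx)).
case=> f [k [L [nE [hw [hc [hs ha]]]]]]; pose e := [:: L; k; n].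
have [l Ll] := iffLR (@fWfP f e k (Var 1) (Var 0) erefl) hw.
have [x fx] := iffLR (@fConfP f e k (Var 1) erefl) hc.
exists (Tagged (fun k => seq (seq (pos * 'I_k))) l); split.
  by move: nE => /= ->; rewrite [L]Ll.
exists x; split; first exact: (iffLR (@fSFTP f e k l x (Var 0) Ll fx) hs).
exact: (iffLR (@fAperP f e k x fx) ha).
Qed.

End Membership.

(** * A normal form for Sigma^1_1 predicates *)

(** Regularity in [recf_min] is required for all oracles, hence it holds for the substituted one. *)
Lemma recursive_subst n (F : functional n) (r : nat -> nat) :
  rec1 (fun _ => r) -> recursive F -> recursive (fun f v => F (fun i => f (r i)) v).
Proof.
move=> rr; elim=> {n F}.
- exact: recf_zero.
- exact: recf_succ.
- apply: recursive_ext (recf_comp1 rec_ask (recf_comp1 rr (recf_proj ord0))) => f v.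
  by congr (nat_of_bool (f (r _))); case/tupleP: v => x v; rewrite theadE tnth0.
- by move=> n i; apply: recf_proj.
- by move=> m n g h _ rg _ rh; apply: recf_comp rg rh.
- by move=> n g h _ rg _ rh; apply: recf_prec rg rh.
- move=> n g reg _ rg.
  exact: (recf_min (fun f v => reg (fun i => f (r i)) v) rg).
Qed.

(** An oracle is split in three: the even numbers carry f, those equal to 1 modulo 4 carry one set,
    those equal to 3 modulo 4 the odd part of a further oracle. [orR] keeps the even positions in
    place, so that this further oracle has the same f. *)
Definition orL (h : oracle) : oracle := fun i => h i.*2.
Definition orM (h : oracle) : oracle := fun i => h (i.*2.*2.+1).
Definition orR (h : oracle) : oracle := fun i => h (if odd i then i.*2.+1 else i).

Definition join3 (f T h : oracle) : oracle := fun i =>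
  if odd i then if odd i./2 then h i./2 else T i./2./2 else f i./2.

Lemma orL_join3 f T h : orL (join3 f T h) = f.
Proof. by apply: functional_extensionality => i; rewrite /orL /join3 odd_double doubleK. Qed.

Lemma orM_join3 f T h : orM (join3 f T h) = T.
Proof.
apply: functional_extensionality => i.
by rewrite /orM /join3 /= odd_double /= uphalf_double odd_double doubleK.
Qed.

Lemma orR_join3 f T h : orL h = f -> orR (join3 f T h) = h.
Proof.
move=> hf; apply: functional_extensionality => i; rewrite /orR /join3.
case i_odd: (odd i) => /=; first by rewrite odd_double /= uphalf_double i_odd.
by rewrite i_odd -hf /orL -[in RHS](odd_double_half i) i_odd.
Qed.

Lemma orL_orR h : orL (orR h) = orL h.
Proof. by apply: functional_extensionality => i; rewrite /orL /orR odd_double. Qed.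

Definition Dbl t := Add t t.

Lemma rec_orR g : rec2 g -> rec2 (fun h => g (orR h)).
Proof.
apply: recursive_subst.
apply: (@rec1_term (Add (Var 0) (Mul (Odd (Var 0)) (Succ (Var 0))))) => f x /=.
by case: odd; rewrite ?mul1n ?addnS ?addnn // mul0n addn0.
Qed.

Lemma rec_orM : rec1 (fun h x => orM h x).
Proof.
apply: (@rec1_term (Query (Succ (Dbl (Dbl (Var 0)))))) => f x /=.
by rewrite !addnn.
Qed.

Lemma rec_orMR : rec1 (fun h x => orM (orR h) x).
Proof.
apply: (@rec1_term (Query (Succ (Dbl (Succ (Dbl (Dbl (Var 0)))))))) => f x /=.
by rewrite !addnn /orM /orR /= odd_double.
Qed.

Lemma rec_imp : rec2 (fun _ x y => (x != 0) ==> (y != 0)).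
Proof.
apply: (@rec2_term (Bnot (Mul (Bnot (Bnot (Var 0))) (Bnot (Var 1))))) => f x y /=.
by case: x; case: y.
Qed.

(* [G] alternates between the instances of a new clause [C] (even m) and those
   already present (odd m), which talk about [orR h]. *)
Definition both (C G : oracle -> nat -> nat -> nat) (h : oracle) (m k : nat) :=
  if odd m then G (orR h) m./2 k else C h m./2 k.

Lemma rec_both C G : rec2 C -> rec2 G -> rec2 (both C G).
Proof.
move=> rC rG; pose m2 := Half (Var 0).
pose A := Mul (Odd (Var 0)) (Ap2 (rec_orR rG) m2 (Var 1)).
apply: (@rec2_term (Add A (Mul (Bnot (Odd (Var 0))) (Ap2 rC m2 (Var 1))))) => h m k.
by rewrite /both /=; case: odd; rewrite ?mul1n ?mul0n ?addn0.
Qed.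

Lemma bothP C G h :
  (forall m, exists k, both C G h m k = 1) <->
  (forall m, exists k, C h m k = 1) /\ (forall m, exists k, G (orR h) m k = 1).
Proof.
split=> [H | [HC HG] m].
  split=> m; [have := H m.*2 | have := H m.*2.+1]; rewrite /both /=.
    by rewrite odd_double doubleK.
  by rewrite odd_double uphalf_double.
by rewrite /both; case: (odd m).
Qed.

Definition truth n (R : n.-tuple nat -> Prop) : oracle := fun j =>
  if excluded_middle_informative (exists2 v : n.-tuple nat, j = CodeSeq.code v & R v)
  then true else false.

Lemma truthP n (R : n.-tuple nat -> Prop) j :
  reflect (exists2 v : n.-tuple nat, j = CodeSeq.code v & R v) (truth R j).
Proof. by rewrite /truth; case: excluded_middle_informative => H; constructor. Qed.

Lemma truth_code n (R : n.-tuple nat -> Prop) (v : n.-tuple nat) : truth R (CodeSeq.code v) <-> R v.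
Proof.
split=> [/truthP [w /(can_inj CodeSeq.codeK) /val_inj ->] // | Rv].
by apply/truthP; exists v.
Qed.

(* Besides f = [orL h], the oracle h stores, for every subformula, its set of true
   instances; [orM h] is the set for the formula itself.  [G] checks that the sets
   are closed under the defining clauses, and is uniform in the instance v. *)
Lemma arithmetical_clauses n (R : oracle -> n.-tuple nat -> Prop) :
    arithmetical R -> exists G, [/\ rec2 G,
    forall f, exists h, [/\ orL h = f, (forall v : n.-tuple nat, R f v -> orM h (CodeSeq.code v)) &
      forall m, exists k, G h m k = 1] &
    forall h, (forall m, exists k, G h m k = 1) ->
      forall v : n.-tuple nat, orM h (CodeSeq.code v) -> R (orL h) v].
Proof.
elim=> {n R} [n F rF | n R _ [G [rG complete sound]] | n R _ [G [rG complete sound]]].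
- pose dec (m : nat) : n.-tuple nat := [tuple nth 0 (CodeSeq.decode m) i | i < n].
  have decE (v : n.-tuple nat) : dec (CodeSeq.code v) = v.
    by apply: eq_from_tnth => i; rewrite tnth_mktuple CodeSeq.codeK (tnth_nth 0).
  pose G h m (k : nat) := nat_of_bool (orM h m ==> (F (orL h) (dec m) == 1)).
  exists G; split=> [|f|h Gh v hv].
  + have rdbl : rec1 (fun _ => double).
      by apply: (@rec1_term (Dbl (Var 0))) => f x /=; rewrite addnn.
    have r1 := recf_comp (recursive_subst rdbl rF)
      (fun i : 'I_n => evalP 2 (Hd (Drop (Cst i) (Var 0)))).
    have r2 := recf_comp2 rec_eq r1 (recS_cst 2 1).
    apply: recursive_ext (recf_comp2 rec_imp (evalP 2 (Ap1 rec_orM (Var 0))) r2) => h v.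
    rewrite /G !eqb0 !negbK; congr (nat_of_bool (_ ==> (F _ _ == 1))).
    by apply: eq_from_tnth => i; rewrite !tnth_mktuple /= chd_cdrop.
  + exists (join3 f (truth (fun v => F f v = 1)) f).
    rewrite orL_join3 orM_join3; split=> // [v Fv|m]; first exact/truth_code.
    exists 0; rewrite /G orL_join3 orM_join3; apply/eqP; rewrite eqb1.
    by apply/implyP => /truthP [v -> Fv]; rewrite decE Fv.
  + have [k0] := Gh (CodeSeq.code v); rewrite /G hv decE => /eqP.
    by rewrite eqb1 => /eqP.
(* Existential case: if [m] codes an instance, [k] is a witness for it and [ccons k m] codes the
   resulting instance of the body. *)
- pose C h m k := nat_of_bool (orM h m ==> orM (orR h) (ccons k m)).
  have rC : rec2 C.
    apply: (@rec2_term (Ap2 rec_imp (Ap1 rec_orM (Var 0))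
       (Ap1 rec_orMR (Cons (Var 1) (Var 0))))) => h m k /=.
    by rewrite !eqb0 !negbK.
  exists (both C G); split=> [|f|h /bothP [Ch Gh] v hv]; first exact: rec_both.
    have [h' [fh' Th' Gh']] := complete f.
    exists (join3 f (truth (fun v => exists m, R f [tuple of m :: v])) h').
    rewrite orL_join3 orM_join3; split=> // [v Rv|]; first exact/truth_code.
    apply/bothP; rewrite orR_join3 //; split=> // m; rewrite /C orM_join3 orR_join3 //.
    case: truthP => [[v -> [a Ra]] | _]; last by exists 0.
    by exists a; have /= -> := Th' _ Ra.
  have [k] := Ch (CodeSeq.code v); rewrite /C hv => /eqP; rewrite eqb1 => kv.
  by exists k; have := sound _ Gh [tuple of k :: v] kv; rewrite orL_orR.
(* Universal case: [m] codes a pair of an instance and a value, so that the quantifier is absorbed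
   by the one on [m]. *)
- pose C h m (k : nat) := nat_of_bool (orM h (chd m) ==> orM (orR h) (ccons (ctl m) (chd m))).
  have rC : rec2 C.
    apply: (@rec2_term (Ap2 rec_imp (Ap1 rec_orM (Hd (Var 0)))
       (Ap1 rec_orMR (Cons (Tl (Var 0)) (Hd (Var 0)))))) => h m k /=.
    by rewrite !eqb0 !negbK.
  exists (both C G); split=> [|f|h /bothP [Ch Gh] v hv m]; first exact: rec_both.
    have [h' [fh' Th' Gh']] := complete f.
    exists (join3 f (truth (fun v => forall m, R f [tuple of m :: v])) h').
    rewrite orL_join3 orM_join3; split=> // [v Rv|]; first exact/truth_code.
    apply/bothP; rewrite orR_join3 //; split=> // m; rewrite /C orM_join3 orR_join3 //.
    exists 0; case: truthP => [[v -> Rv] | _] //.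
    by have /= -> := Th' _ (Rv (ctl m)).
  have [k0] := Ch (ccons (CodeSeq.code v) m).
  rewrite /C chd_ccons ctl_ccons hv => /eqP; rewrite eqb1 => kv.
  by have := sound _ Gh [tuple of m :: v] kv; rewrite orL_orR.
Qed.

Lemma Sigma11_normal_form (Q : nat -> Prop) : Sigma11 Q ->
  exists G : oracle -> nat -> nat -> nat -> nat,
    recS 3 (fun h s => G h (nth 0 s 0) (nth 0 s 1) (nth 0 s 2)) /\
    forall n, Q n <-> exists h, forall m, exists k, G h n m k = 1.
Proof.
case=> R [/arithmetical_clauses [G [rG complete sound]] QR].
(* [2 ^ n] codes the instance [[:: n]]. The conjunct about it depends neither on [m] nor on [k], so
   it can stand under both quantifiers. *)
pose D h n m k := nat_of_bool (orM h (2 ^ n) && (G h m k == 1)).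
exists D; split.
  apply: (@recS_term 3 (Mul (Ap1 rec_orM (Pow2 (Var 0)))
    (Beq (Ap2 rG (Var 1) (Var 2)) (Cst 1)))) => h v /=.
  by rewrite /D; case: orM; case: eqP.
have code2 n : CodeSeq.code [tuple n] = 2 ^ n by rewrite code1.
move=> n; rewrite QR; split=> [[f /= Rf] | [h Dh]].
  have [h [fh Th Gh]] := complete f; exists h => m; have [k Gk] := Gh m; exists k.
  by rewrite /D -code2 Th // Gk.
exists (orL h); apply: sound => [m|].
  by have [k /eqP] := Dh m; rewrite eqb1 => /andP [_ /eqP ?]; exists k.
by have [k /eqP] := Dh 0; rewrite eqb1 -code2 => /andP [].
Qed.

(** * Register machines *)

Inductive instr : Type :=
| IZero of nat
| ISucc of nat & nat
| ICopy of nat & nat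
| IJeq of nat & nat & nat
| IAsk of nat & nat.

Definition upd (e : nat -> nat) r x : nat -> nat := fun i => if i == r then x else e i.

Lemma upd_same e r x : upd e r x r = x.
Proof. by rewrite /upd eqxx. Qed.

Lemma upd_other e r x i : i <> r -> upd e r x i = e i.
Proof. by rewrite /upd; case: eqP. Qed.

(** The default makes the machine run for ever: from the extra state [size P] it jumps back to 0. *)
Definition fetch (P : seq instr) q := nth (IJeq 0 0 0) P q.

(* The program counter is clamped so that states range over ['I_(size P).+1]. *)
Definition step (P : seq instr) (h : oracle) (c : nat * (nat -> nat)) :=
  let: (q, e) := c in
  let goto t := minn t (size P) in
  match fetch P q with
  | IZero r => (goto q.+1, upd e r 0)
  | ISucc r s => (goto q.+1, upd e r (e s).+1)
  | ICopy r s => (goto q.+1, upd e r (e s))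
  | IJeq r s t => (goto (if e r == e s then t else q.+1), e)
  | IAsk r t => (goto (if h (e r) then t else q.+1), e)
  end.

(** The bounds confine every state but the last; they serve to show that a stretch of a run avoids a
    given state. *)
Inductive runs P h (lo hi : nat) : nat * (nat -> nat) -> nat * (nat -> nat) -> Prop :=
| runs0 c : runs P h lo hi c c
| runsS c c' : lo <= c.1 < hi -> runs P h lo hi (step P h c) c' -> runs P h lo hi c c'.

Lemma runs_trans P h lo hi c1 c2 c3 :
  runs P h lo hi c1 c2 -> runs P h lo hi c2 c3 -> runs P h lo hi c1 c3.
Proof. by elim=> // c c' Hc _ IH /IH; apply: runsS. Qed.

Lemma runs_sub P h lo hi lo' hi' c c' :
  lo' <= lo -> hi <= hi' -> runs P h lo hi c c' -> runs P h lo' hi' c c'.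
Proof.
move=> lo_le hi_le; elim=> [?|c1 c2 /andP [l1 l2] _ IH]; first exact: runs0.
by apply: runsS IH; rewrite (leq_trans lo_le l1) (leq_trans l2 hi_le).
Qed.

Section OneStep.

Variables (P : seq instr) (h : oracle) (lo hi q : nat) (e : nat -> nat).
Variable c : nat * (nat -> nat).
Hypotheses (qlh : lo <= q < hi) (qP : q < size P).

Lemma runs_zero r : fetch P q = IZero r ->
  runs P h lo hi (q.+1, upd e r 0) c -> runs P h lo hi (q, e) c.
Proof. by move=> fq R; apply: runsS; rewrite //= fq (minn_idPl _). Qed.

Lemma runs_succ r s : fetch P q = ISucc r s ->
  runs P h lo hi (q.+1, upd e r (e s).+1) c -> runs P h lo hi (q, e) c.
Proof. by move=> fq R; apply: runsS; rewrite //= fq (minn_idPl _). Qed.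

Lemma runs_copy r s : fetch P q = ICopy r s ->
  runs P h lo hi (q.+1, upd e r (e s)) c -> runs P h lo hi (q, e) c.
Proof. by move=> fq R; apply: runsS; rewrite //= fq (minn_idPl _). Qed.

Lemma runs_jeq r s t : fetch P q = IJeq r s t -> t <= size P ->
  runs P h lo hi (if e r == e s then t else q.+1, e) c -> runs P h lo hi (q, e) c.
Proof. by move=> fq tP R; apply: runsS; rewrite //= fq (minn_idPl _) //; case: ifP. Qed.

Lemma runs_ask r t : fetch P q = IAsk r t -> t <= size P ->
  runs P h lo hi (if h (e r) then t else q.+1, e) c -> runs P h lo hi (q, e) c.
Proof. by move=> fq tP R; apply: runsS; rewrite //= fq (minn_idPl _) //; case: ifP. Qed.

End OneStep.

Lemma runs_iter P h lo hi c c' : runs P h lo hi c c' ->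
  exists t, iter t (step P h) c = c' /\
    forall t', t' < t -> lo <= (iter t' (step P h) c).1 < hi.
Proof.
elim=> [c1|c1 c2 c1P _ [t [tE tP]]]; first by exists 0.
exists t.+1; split=> [|[|t'] lt_t]; rewrite ?iterSr //; exact: tP.
Qed.

(** * Compilation of recursive functionals *)

Definition code_at (P : seq instr) s (C : seq instr) :=
  exists A B, P = A ++ C ++ B /\ size A = s.

Lemma code_at_cat P s C D : code_at P s (C ++ D) ->
  code_at P s C /\ code_at P (s + size C) D.
Proof.
case=> A [B [-> <-]]; split; first by exists A, (D ++ B); rewrite !catA.
by exists (A ++ C), B; rewrite size_cat !catA.
Qed.

Lemma code_at_cons P s i C : code_at P s (i :: C) -> fetch P s = i /\ code_at P s.+1 C.
Proof.
case=> A [B [-> <-]]; split; first by rewrite /fetch nth_cat ltnn subnn.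
by exists (rcons A i), B; rewrite size_rcons cat_rcons.
Qed.

Lemma code_at_size P s C : code_at P s C -> s + size C <= size P.
Proof. by case=> A [B [-> <-]]; rewrite !size_cat addnA leq_addr. Qed.

(** Jump targets are absolute, so code is produced for a fixed start address [s]. *)
Definition implements n (F : functional n) (a : n.-tuple nat) r b s C :=
  forall P h e, code_at P s C -> exists e',
    [/\ runs P h s (s + size C) (s, e) (s + size C, e'),
        e' r = F h [tuple of map e a] &
        forall i, i < b -> i <> r -> e' i = e i].

(* a: argument registers; r: result register; registers from b on are scratch. *)
Definition compilable n (F : functional n) :=
  forall (a : n.-tuple nat) r b s, all (fun i => i < b) a -> r < b ->
    exists C, implements F a r b s C.

Lemma eq_map_tuple n (a : n.-tuple nat) (e e' : nat -> nat) :
  (forall i, i \in a -> e i = e' i) -> [tuple of map e a] = [tuple of map e' a].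
Proof. by move=> ee'; apply: val_inj; apply/eq_in_map. Qed.

Lemma compile_zero : compilable (fun _ (_ : 0.-tuple nat) => 0).
Proof.
move=> a r b s _ _; exists [:: IZero r] => P h e /[dup] /code_at_size.
rewrite /= addn1 => sP /code_at_cons [fs _]; exists (upd e r 0); split.
- by apply: (runs_zero _ _ fs); rewrite ?leqnn ?ltnSn //; apply: runs0.
- exact: upd_same.
- by move=> i _ /upd_other ->.
Qed.

Lemma compile_succ : compilable (fun _ (v : 1.-tuple nat) => (thead v).+1).
Proof.
move=> a r b s _ _; exists [:: ISucc r (thead a)] => P h e /[dup] /code_at_size.
rewrite /= addn1 => sP /code_at_cons [fs _]; exists (upd e r (e (thead a)).+1); split.
- by apply: (runs_succ _ _ fs); rewrite ?leqnn ?ltnSn //; apply: runs0.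
- by rewrite upd_same /thead tnth_map.
- by move=> i _ /upd_other ->.
Qed.

Lemma compile_proj n (i : 'I_n) : compilable (fun _ (v : n.-tuple nat) => tnth v i).
Proof.
move=> a r b s _ _; exists [:: ICopy r (tnth a i)] => P h e /[dup] /code_at_size.
rewrite /= addn1 => sP /code_at_cons [fs _]; exists (upd e r (e (tnth a i))); split.
- by apply: (runs_copy _ _ fs); rewrite ?leqnn ?ltnSn //; apply: runs0.
- by rewrite upd_same tnth_map.
- by move=> j _ /upd_other ->.
Qed.

Lemma compile_oracle : compilable (fun f (v : 1.-tuple nat) => nat_of_bool (f (thead v))).
Proof.
move=> a r b s _ _.
(* [IJeq r r] is an unconditional jump; it skips the branch at [s.+3], which sets [r] to 1. *)
exists [:: IAsk (thead a) s.+3; IZero r; IJeq r r s.+4.+1; IZero r; ISucc r r] => P h e.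
move=> /[dup] /code_at_size; rewrite /= !addnS addn0 => sP.
case/code_at_cons=> f0 /code_at_cons [f1] /code_at_cons [f2] /code_at_cons [f3].
case/code_at_cons=> f4 _.
pose e' := if h (e (thead a)) then upd (upd e r 0) r (upd e r 0 r).+1 else upd e r 0.
exists e'; split.
- apply: (runs_ask _ _ f0); [lia|lia|lia|]; rewrite /e'; case: ifP => _.
    apply: (runs_zero _ _ f3); [lia|lia|].
    by apply: (runs_succ _ _ f4); [lia|lia|]; apply: runs0.
  apply: (runs_zero _ _ f1); [lia|lia|].
  by apply: (runs_jeq _ _ f2); [lia|lia|lia|]; rewrite eqxx; apply: runs0.
- rewrite /e' /thead tnth_map; case: ifP => _; by rewrite !upd_same.
- by move=> i _ ir; rewrite /e'; case: ifP => _; rewrite !upd_other.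
Qed.

(** The values of the [h i] are computed in turn into the registers [b + i], with scratch space from
    [b + m] on, so that neither the arguments nor earlier values are overwritten. *)
Lemma compile_comp m n (g : functional m) (h : 'I_m -> functional n) :
    compilable g -> (forall i, compilable (h i)) ->
  compilable (fun f (v : n.-tuple nat) => g f [tuple h i f v | i < m]).
Proof.
move=> Cg Ch a r b s ab rb.
have [C HC] : exists C, forall P f e, code_at P s C -> exists e',
    [/\ runs P f s (s + size C) (s, e) (s + size C, e'),
        forall i : 'I_m, e' (b + i) = h i f [tuple of map e a] &
        forall i, i < b -> e' i = e i].
  suff key j : j <= m -> exists C, forall P f e, code_at P s C -> exists e',
      [/\ runs P f s (s + size C) (s, e) (s + size C, e'),
          forall i : 'I_m, i < j -> e' (b + i) = h i f [tuple of map e a] &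
          forall i, i < b -> e' i = e i].
    have [C HC] := key m (leqnn m).
    exists C => P f e /(HC P f e) [e' [He1 He2 He3]].
    by exists e'; split=> // i; apply: He2.
  elim: j => [|j IHj] jm.
    exists [::] => P f e _; exists e; split=> //.
    by rewrite addn0; apply: runs0.
  have [C HC] := IHj (ltnW jm); pose i0 := Ordinal jm.
  have [|| D HD] := Ch i0 a (b + j) (b + m) (s + size C).
  - by apply: sub_all ab => i; apply: ltn_addr.
  - by rewrite ltn_add2l.
  exists (C ++ D) => P f e /code_at_cat [/(HC P f e) [e1 [R1 V1 S1]]].
  case/(HD P f e1)=> e2 [R2 V2 S2]; exists e2; split.
  - rewrite size_cat addnA; apply: runs_trans.
      by apply: runs_sub R1; lia.
    by apply: runs_sub R2; lia.
  - move=> i; rewrite ltnS leq_eqVlt => /orP [/eqP ij | ij].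
      have -> : i = i0 by apply: val_inj.
      rewrite V2; congr (h _ _ _); apply: eq_map_tuple => k ka.
      by apply: S1; apply: (allP ab).
    by rewrite S2 ?V1 //; [have := ltn_ord i|]; lia.
  - by move=> i ib; rewrite S2 ?S1 //; lia.
pose a' := [tuple b + i | i < m].
have [|| D HD] := Cg a' r (b + m) (s + size C).
- by apply/allP => x /mapP [i _ ->]; rewrite ltn_add2l.
- exact: ltn_addr.
exists (C ++ D) => P f e /code_at_cat [/(HC P f e) [e1 [R1 V1 S1]]].
case/(HD P f e1)=> e2 [R2 V2 S2]; exists e2; split.
- rewrite size_cat addnA; apply: runs_trans.
    by apply: runs_sub R1; lia.
  by apply: runs_sub R2; lia.
- rewrite V2; congr (g _ _); apply: eq_from_tnth => i.
  by rewrite tnth_map !tnth_mktuple V1.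
- by move=> i ib ir; rewrite S2 ?S1 // ltn_addr.
Qed.

(** Register [b] counts, [b.+1] holds the value so far and [b.+2] receives the next one. The loop
    test is at [s1] and the exit at [s2.+3]. Register [r] is written last, as it may be one of the
    arguments. *)
Lemma compile_prec n (g : functional n) (h : functional n.+2) :
    compilable g -> compilable h ->
  compilable (fun f (v : n.+1.-tuple nat) =>
      let u : n.-tuple nat := [tuple of behead v] in
      iteri (thead v) (fun k r => h f [tuple of k :: r :: u]) (g f u)).
Proof.
move=> Cg Ch a r b s; case/tupleP: a => a0 a /= /andP [a0b ab] rb.
have ab3 x : x \in a -> x < b by move/(allP ab).
have [|| G HG] := Cg a b.+1 b.+3 s; [|lia|].
  by apply/allP => x /ab3; lia.
pose s1 := (s + size G).+1.
have [|| H HH] := Ch [tuple of b :: b.+1 :: a] b.+2 b.+3 s1.+1; [|lia|].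
  by rewrite /=; do 2![apply/andP; split; first by lia]; apply/allP => x /ab3; lia.
pose s2 := s1.+1 + size H.
exists (G ++ IZero b :: IJeq b a0 s2.+3 ::
        H ++ [:: ICopy b.+1 b.+2; ISucc b b; IJeq b b s1; ICopy r b.+1]) => P f e.
move=> /[dup] /code_at_size sP /code_at_cat [/(HG P f e) [e1 [R1 V1 S1]]].
case/code_at_cons=> fz /code_at_cons [fj] /code_at_cat [{}HH'].
case/code_at_cons=> f1 /code_at_cons [f2] /code_at_cons [f3] /code_at_cons [f4 _].
move: sP; set hi := s + size _; have hiE : hi = s2.+4.
  by rewrite /hi !size_cat /= size_cat /= /s2 /s1; lia.
rewrite hiE => sP.
pose u := [tuple of map e a].
pose I k := iteri k (fun k r => h f [tuple of k :: r :: u]) (g f u).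
(* Induction on the number [d] of rounds still to be made, [k] being those already made. *)
have loop d k e' : k + d = e a0 -> e' b = k -> e' b.+1 = I k ->
    (forall i, i < b -> e' i = e i) -> exists e'',
    [/\ runs P f s s2.+4 (s1, e') (s2.+3, e''), e'' b.+1 = I (e a0) &
        forall i, i < b -> e'' i = e i].
  elim: d k e' => [|d IHd] k e' kd ek eI ee.
    exists e'; rewrite -kd addn0; split=> //.
    apply: (runs_jeq _ _ fj); [by rewrite /s2 /s1; lia|by rewrite /s2 in sP; lia|lia|].
    by rewrite ek ee // -kd addn0 eqxx; apply: runs0.
  have [e2 [R2 V2 S2]] := HH P f e' HH'.
  pose e3 := upd (upd e2 b.+1 (e2 b.+2)) b k.+1.
  have e3b1 : e3 b.+1 = I k.+1.
    rewrite /e3 upd_other ?upd_same ?V2; last by lia.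
    rewrite /I /= -/(I k) -eI -[X in _ = h f [tuple of X :: _ :: _]]ek.
    congr (h f _); apply: val_inj => /=; congr [:: _, _ & _].
    by apply/eq_in_map => i /ab3 /ee.
  have [|||e4 [R4 V4 S4]] := IHd k.+1 e3 _ _ e3b1; first by lia.
  - by rewrite /e3 upd_same.
  - by move=> i ib; rewrite /e3 !upd_other ?S2 ?ee //; lia.
  exists e4; split=> //; apply: (runs_jeq _ _ fj).
  - by rewrite /s2 /s1; lia.
  - by rewrite /s2 in sP; lia.
  - by lia.
  rewrite ek ee // ifN; last by lia.
  apply: runs_trans; first by apply: runs_sub R2; rewrite /s2 /s1; lia.
  apply: (runs_copy _ _ f1); [by rewrite /s2 /s1; lia|lia|].
  apply: (runs_succ _ _ f2); [by rewrite /s2 /s1; lia|lia|].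
  apply: (runs_jeq _ _ f3); [by rewrite /s2 /s1; lia|lia|by rewrite /s2 in sP; lia|].
  suff eb : upd e2 b.+1 (e2 b.+2) b = k by rewrite eqxx eb.
  by rewrite upd_other ?S2 ?ek //; lia.
have [||||e3 [R3 V3 S3]] := loop (e a0) 0 (upd e1 b 0).
- by [].
- exact: upd_same.
- by rewrite upd_other ?V1 //; lia.
- by move=> i ib; rewrite upd_other ?S1 //; lia.
exists (upd e3 r (e3 b.+1)); split.
- apply: runs_trans; first by apply: runs_sub R1; rewrite /s2 /s1; lia.
  apply: (runs_zero _ _ fz); [by rewrite /s2 /s1; lia|by rewrite /s2 /s1 in sP; lia|].
  apply: runs_trans R3 _.
  apply: (runs_copy _ _ f4); [by rewrite /s2 /s1; lia|lia|]; exact: runs0.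
- have uE : u = [tuple of behead [tuple of map e [tuple of a0 :: a]]] by apply: val_inj.
  by rewrite upd_same V3 /I uE.
- by move=> i ib ir; rewrite upd_other ?S3.
Qed.

(** Register [b] holds the candidate, [b.+1] the value of [g] there, and [b.+2] a constant 0 to
    compare with. The loop ends because the least zero is known to exist. *)
Lemma compile_min n (g : functional n.+1)
    (reg : forall f (v : n.-tuple nat), exists m, g f [tuple of m :: v] == 0) :
  compilable g -> compilable (fun f (v : n.-tuple nat) => ex_minn (reg f v)).
Proof.
move=> Cg a r b s ab rb.
have ab3 x : x \in a -> x < b by move/(allP ab).
pose s1 := s.+2.
have [|| G HG] := Cg [tuple of b :: a] b.+1 b.+3 s1; [|lia|].
  by rewrite /=; apply/andP; split; first lia; apply/allP => x /ab3; lia.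
pose s2 := s1 + size G.
exists (IZero b :: IZero b.+2 :: G ++
        [:: IJeq b.+1 b.+2 s2.+3; ISucc b b; IJeq b b s1; ICopy r b]) => P f e.
move=> /[dup] /code_at_size sP /code_at_cons [f0] /code_at_cons [f1].
case/code_at_cat=> HG' /code_at_cons [f2] /code_at_cons [f3].
case/code_at_cons=> [f4] /code_at_cons [f5 _].
move: sP; set hi := s + size _; have hiE : hi = s2.+4.
  by rewrite /hi /= size_cat /= /s2 /s1; lia.
rewrite hiE => sP; have s2E : s2 = s.+2 + size G by [].
rewrite -/s2 in f2 f3 f4 f5.
case: ex_minnP => m /eqP gm mmin.
set u := [tuple of map e a] in gm mmin.
have body k e' : e' b = k -> e' b.+2 = 0 -> (forall i, i < b -> e' i = e i) ->
    exists e2, [/\ runs P f s s2.+4 (s1, e') (s2, e2), e2 b.+1 = g f [tuple of k :: u],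
      e2 b = k, e2 b.+2 = 0 & forall i, i < b -> e2 i = e i].
  move=> ek ez ee; have [e2 [R2 V2 S2]] := HG P f e' HG'; exists e2; split.
  - by apply: runs_sub R2; rewrite /s1; lia.
  - rewrite V2 -[X in _ = g _ [tuple of X :: _]]ek; congr (g f _).
    by apply: val_inj => /=; congr (_ :: _); apply/eq_in_map => i /ab3 /ee.
  - by rewrite S2 ?ek; lia.
  - by rewrite S2 ?ez; lia.
  - by move=> i ib; rewrite S2 ?ee //; lia.
have loop d k e' : k + d = m -> e' b = k -> e' b.+2 = 0 ->
    (forall i, i < b -> e' i = e i) -> exists e'',
    [/\ runs P f s s2.+4 (s1, e') (s2.+3, e''), e'' b = m &
        forall i, i < b -> e'' i = e i].
  elim: d k e' => [|d IHd] k e' kd ek ez ee; have [e2 [R2 g2 k2 z2 S2]] := body k e' ek ez ee.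
    exists e2; split=> //; last by rewrite k2 -kd addn0.
    apply: runs_trans R2 _; apply: (runs_jeq _ _ f2); [lia|lia|lia|].
    by rewrite addn0 in kd; rewrite g2 z2 kd gm eqxx; apply: runs0.
  have [||||e4 [R4 V4 S4]] := IHd k.+1 (upd e2 b k.+1); first by lia.
  - exact: upd_same.
  - by rewrite upd_other ?z2; lia.
  - by move=> i ib; rewrite upd_other ?S2; lia.
  exists e4; split=> //; apply: runs_trans R2 _.
  apply: (runs_jeq _ _ f2); [lia|lia|lia|].
  rewrite g2 z2 ifN; last by apply/negP => /mmin; lia.
  apply: (runs_succ _ _ f3); [lia|lia|].
  apply: (runs_jeq _ _ f4); [lia|lia|by rewrite /s1; lia|].
  by rewrite eqxx k2.
have [||||e3 [R3 V3 S3]] := loop m 0 (upd (upd e b 0) b.+2 0).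
- by [].
- by rewrite upd_other ?upd_same; lia.
- exact: upd_same.
- by move=> i ib; rewrite !upd_other //; lia.
exists (upd e3 r (e3 b)); split.
- apply: (runs_zero _ _ f0); [lia|lia|].
  apply: (runs_zero _ _ f1); [lia|lia|].
  apply: runs_trans R3 _.
  by apply: (runs_copy _ _ f5); [lia|lia|]; apply: runs0.
- by rewrite upd_same V3.
- by move=> i ib ir; rewrite upd_other ?S3.
Qed.

Lemma recursive_compilable n (F : functional n) : recursive F -> compilable F.
Proof.
elim=> {n F}.
- exact: compile_zero.
- exact: compile_succ.
- exact: compile_oracle.
- exact: compile_proj.
- by move=> m n g h _ Cg _ Ch; apply: compile_comp.
- by move=> n g h _ Cg _ Ch; apply: compile_prec.
- by move=> n g reg _ Cg; apply: compile_min.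
Qed.

(** * The search machine *)

Definition init N : nat -> nat := fun r => if r == 0 then N else 0.

Definition trace P h N y := iter y (step P h) (0, init N).

Definition marks_unbounded P mu rho h N :=
  forall B, exists2 y, (trace P h N y).1 = mu & B <= (trace P h N y).2 rho.

Lemma bounded_below (g : nat -> nat) n : exists B, forall y, y < n -> g y < B.
Proof.
elim: n => [|n [B IH]]; first by exists 0.
exists (maxn B (g n).+1) => y; rewrite ltnS leq_eqVlt leq_max => /orP [/eqP -> | /IH ->] //.
by rewrite ltnSn orbT.
Qed.

(* The machine searches, for m = 0, 1, ..., some k with F (N, m, k) = 1, and passes
   through the state mu, with m in register rho, when it finds one. *)
Lemma search_machine (F : functional 3) : recursive F ->
  exists P mu rho, forall h N, marks_unbounded P mu rho h N <->
    forall m, exists k, F h [tuple N; m; k] = 1.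
Proof.
(* Registers 0, 1, 2 hold N, m, k, register 3 receives the value of [F], register 4 holds the
   constant 1 and scratch space starts at 5. The code of [F] starts at address 2, after two initial
   instructions. *)
move=> /recursive_compilable /(_ [tuple 0; 1; 2] 3 5 2 isT isT) [C HC].
pose s2 := 2 + size C; pose mu := s2.+3.
(* The copy of register 1 to itself changes nothing: it makes [mu] a separate state, in which m has
   not yet been incremented. *)
pose P := ISucc 4 2 :: IZero 2 :: C ++ [:: IJeq 3 4 mu; ISucc 2 2; IJeq 0 0 2;
  ICopy 1 1; ISucc 1 1; IJeq 0 0 1].
have PE : code_at P 0 P by exists [::], [::]; rewrite cats0.
have sP : size P = s2 + 6 by rewrite /P /= size_cat /= /s2; lia.
have [f0 PE1] := code_at_cons PE; have [f1 /code_at_cat [PC PE2]] := code_at_cons PE1.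
have [g0 /code_at_cons [g1 /code_at_cons [g2]]] := code_at_cons PE2.
case/code_at_cons=> [g3 /code_at_cons [g4]] /code_at_cons [g5 _].
rewrite -/s2 in g0 g1 g2 g3 g4 g5.
exists P, mu, 1 => h N.
pose inv m k (e : nat -> nat) := [/\ e 0 = N, e 1 = m, e 2 = k & e 4 = 1].
have try m k e : inv m k e -> exists e',
    [/\ runs P h 2 mu (2, e) (s2, e'), e' 3 = F h [tuple N; m; k] & inv m k e'].
  case=> e0 e1 e2 e4; have [e' [R V S]] := HC P h e PC; exists e'; split.
  - by apply: runs_sub R; rewrite /mu /s2; lia.
  - by rewrite V; congr (F h _); apply: val_inj; rewrite /= e0 e1 e2.
  - by split; rewrite S.
have s2_2 : 2 <= s2 by [].
have again m k e : inv m k e -> F h [tuple N; m; k] <> 1 ->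
    exists2 e', runs P h 2 mu (2, e) (2, e') & inv m k.+1 e'.
  move=> /try [e1 [R V [i0 i1 i2 i4]]] Fn1; exists (upd e1 2 k.+1); last by split.
  apply: runs_trans R _; apply: (runs_jeq _ _ g0); [rewrite /mu; lia|lia|rewrite /mu; lia|].
  rewrite V i4 ifN; last by apply/eqP.
  apply: (runs_succ _ _ g1); [rewrite /mu; lia|lia|].
  apply: (runs_jeq _ _ g2); [rewrite /mu; lia|lia|lia|].
  by rewrite eqxx i2; apply: runs0.
have found m k e : inv m k e -> F h [tuple N; m; k] = 1 ->
    exists2 e', runs P h 2 mu (2, e) (mu, e') & inv m k e'.
  move=> /try [e1 [R V [i0 i1 i2 i4]]] F1; exists e1; last by split.
  apply: runs_trans R _; apply: (runs_jeq _ _ g0); [rewrite /mu; lia|lia|rewrite /mu; lia|].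
  by rewrite V i4 F1 eqxx; apply: runs0.
have next m k e : inv m k e ->
    exists2 e', runs P h 0 (size P) (mu, e) (2, e') & inv m.+1 0 e'.
  case=> i0 i1 i2 i4; exists (upd (upd (upd e 1 (e 1)) 1 m.+1) 2 0); last by split.
  apply: (runs_copy _ _ g3); [rewrite /mu; lia|rewrite /mu; lia|].
  apply: (runs_succ _ _ g4); [rewrite /mu; lia|rewrite /mu; lia|].
  apply: (runs_jeq _ _ g5); [rewrite /mu; lia|rewrite /mu; lia|lia|].
  rewrite eqxx; apply: (runs_zero _ _ f1); [lia|lia|].
  by rewrite upd_same i1; apply: runs0.
have muP : mu <= size P by rewrite /mu; lia.
have wide c c' : runs P h 2 mu c c' -> runs P h 0 (size P) c c' by apply: runs_sub.
have succeed m e : inv m 0 e -> (exists k, F h [tuple N; m; k] = 1) ->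
    exists k, exists2 e', runs P h 0 (size P) (2, e) (mu, e') & inv m k e'.
  move=> ie [k Fk].
  suff go d j e1 : j + d = k -> inv m j e1 ->
      exists k, exists2 e', runs P h 0 (size P) (2, e1) (mu, e') & inv m k e'.
    exact: go (add0n k) ie.
  elim: d j e1 => [|d IHd] j e1 jd ie1.
    rewrite addn0 in jd; rewrite -jd in Fk; exists j.
    by have [e' /wide R ie'] := found m j e1 ie1 Fk; exists e'.
  have [F1 | Fn1] := eqVneq (F h [tuple N; m; j]) 1.
    by exists j; have [e' /wide R ie'] := found m j e1 ie1 F1; exists e'.
  have [e2 /wide R2 ie2] := again m j e1 ie1 (elimN eqP Fn1).
  have [|k' [e' R' ie']] := IHd j.+1 e2 _ ie2; first by lia.
  by exists k', e' => //; apply: runs_trans R2 R'.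
have reach m : (forall m', m' < m -> exists k, F h [tuple N; m'; k] = 1) ->
    exists2 e, runs P h 0 (size P) (0, init N) (2, e) & inv m 0 e.
  elim: m => [|m IHm] Hm.
    exists (upd (upd (init N) 4 1) 2 0); last by split.
    apply: (runs_succ _ _ f0); [lia|lia|].
    by apply: (runs_zero _ _ f1); [lia|lia|]; apply: runs0.
  have [|e R ie] := IHm; first by move=> m' mm'; apply: Hm; apply: ltnW.
  have [k [e1 R1 ie1]] := succeed m e ie (Hm m (ltnSn m)).
  have [e2 R2 ie2] := next m k e1 ie1.
  by exists e2 => //; apply: runs_trans R (runs_trans R1 R2).
split=> [unb m | H B]; last first.
  have [e R ie] := reach B (fun m _ => H m).
  have [k [e1 R1 [_ e1B _ _]]] := succeed B e ie (H B).
  have [t [tE _]] := runs_iter (runs_trans R R1).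
  by exists t; rewrite /trace tE //= e1B.
elim/ltn_ind: m => m IHm; apply: NNPP => fails.
have [e /runs_iter [y0 [y0E _]] ie] := reach m IHm.
(* If no k works for [m], then from time [y0] on the machine tries k = 0, 1, 2, ... without meeting
   [mu]. So all marks lie before [y0] and their values are bounded. *)
have never j : exists t e1, [/\ j <= t, trace P h N (t + y0) = (2, e1), inv m j e1 &
    forall t', t' < t -> (trace P h N (t' + y0)).1 <> mu].
  elim: j => [|j [t [e1 [jt tE ie1 tP]]]]; first by exists 0, e.
  have [|e2 /runs_iter [u [uE uP]] ie2] := again m j e1 ie1.
    by move=> F1; apply: fails; exists j.
  exists (u + t), e2; split=> //.
  (* At least one step is made, since register 2 has changed from [j] to [j.+1]. *)
  - case: u uE {uP} => [|u _] /=; last by lia.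
    by case=> e12; case: ie1; case: ie2 => _ _; rewrite e12 => -> _ _ _; lia.
  - by rewrite /trace -addnA iterD -/(trace _ _ _ _) tE.
  - move=> t' lt_t'; have [|le_t] := ltnP t' t; first exact: tP.
    rewrite -(subnK le_t) -addnA /trace iterD -/(trace _ _ _ _) tE.
    by have := uP (t' - t); lia.
have [B HB] := bounded_below (fun y => (trace P h N y).2 1) y0.
have [y yE By] := unb B.
have [lt_y | le_y] := ltnP y y0; first by have := HB y lt_y; rewrite ltnNge By.
have [t [e1 [lt_t _ _ tP]]] := never (y - y0).+1.
by apply: (tP (y - y0) lt_t); rewrite subnK.
Qed.

(** * SFTs given by rules on pairs of cells *)

Section PairRules.

Variables (d : nat) (S : finType).
Notation pos := (d.-tuple int).

Definition rule := (pos * rel S)%type.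

(** [List.In] is used because rules contain relations, which have no boolean equality here. *)
Definition obeys (rs : seq rule) (x : config d S) :=
  forall u R, List.In (u, R) rs -> forall i, R (x i) (x (i + rowt u)%R).

Definition origin : pos := [tuple 0%R | _ < d].

Lemma rowt_origin : rowt origin = 0%R.
Proof. by apply/rowP => j; rewrite !mxE tnth_mktuple. Qed.

Definition forbid (r : rule) : seq (seq (pos * 'I_#|S|)) :=
  [seq [:: (origin, enum_rank ab.1); (r.1, enum_rank ab.2)]
     | ab : S * S <- enum {: S * S} & ~~ r.2 ab.1 ab.2].

Definition rules_instance (rs : seq rule) : instance d :=
  Tagged (fun k => seq (seq (pos * 'I_k))) (flatten (map forbid rs)).

(** With a zero offset the two entries would share a position and the second would be lost. *)
Lemma appears_pair (u : pos) (a b : S) (x : config d 'I_#|S|) : u != origin ->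
  appears (pattern_of [:: (origin, enum_rank a); (u, enum_rank b)]) x <->
  exists i, x i = enum_rank a /\ x (i + rowt u)%R = enum_rank b.
Proof.
move=> u0; rewrite appears_fnd; split=> -[i H]; exists i.
  split; last apply: H.
    rewrite -[i in x i]addr0 -rowt_origin; apply: H.
    by rewrite fnd_pattern_of /= eqxx.
  by rewrite fnd_pattern_of /= eq_sym (negPf u0) eqxx.
case: H => xa xb j c; rewrite -[j]tuprK fnd_pattern_of /= ![_ == tupr j]eq_sym.
have [-> [<-] | _] := eqVneq (tupr j) origin; first by rewrite rowt_origin addr0.
by have [-> [<-] | _] := eqVneq (tupr j) u.
Qed.

Lemma rules_instanceP (rs : seq rule) (x : config d 'I_#|S|) :
    (forall r, List.In r rs -> r.1 != origin) ->
  SFT (family_of (rules_instance rs)) x <-> obeys rs (fun i => enum_val (x i)).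
Proof.
move=> rs0; rewrite /SFT /family_of /=.
have mem_forbid w : w \in map (@pattern_of d #|S|) (flatten (map forbid rs)) <->
    exists u R a b, [/\ List.In (u, R) rs, ~~ R a b &
      w = pattern_of [:: (origin, enum_rank a); (u, enum_rank b)]].
  elim: rs {rs0} => [|[u R] rs IHrs] /=; first by split=> // -[? [? [? [? []]]]].
  rewrite map_cat mem_cat; split.
    case/orP => [/mapP [l /mapP [[a b] abP ->] ->] | /IHrs [v [R' [a [b [? ? ?]]]]]].
      move: abP; rewrite mem_filter => /andP [/= nR _].
      by exists u, R, a, b; split=> //; left.
    by exists v, R', a, b; split=> //; right.
  case=> v [R' [a [b [[[<- <-] | vR] nR wE]]]]; apply/orP; [left|right]; last first.
    by apply/IHrs; exists v, R', a, b.
  apply/mapP; exists [:: (origin, enum_rank a); (u, enum_rank b)] => //.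
  apply/mapP; exists (a, b) => //; rewrite mem_filter /= nR mem_enum //.
split=> [H u R uR i | H w /mem_forbid [u [R [a [b [uR nR ->]]]]]].
  apply: contraT => nR.
  have [] := H (pattern_of [:: (origin, x i); (u, x (i + rowt u)%R)]).
    apply/mem_forbid; exists u, R, (enum_val (x i)), (enum_val (x (i + rowt u)%R)).
    by rewrite !enum_valK.
  rewrite -[x i]enum_valK -[x (i + _)%R]enum_valK; apply/appears_pair.
    exact: rs0 uR.
  by exists i; rewrite !enum_valK.
case/appears_pair => [|i [xa xb]]; first exact: rs0 uR.
by have := H u R uR i; rewrite xa xb !enum_rankK (negPf nR).
Qed.

(** Symbols are renamed by the bijection [enum_rank]; being injective, it preserves broken
    vectors. *)
Lemma aperiodic_domino_rules (rs : seq rule) :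
    (forall r, List.In r rs -> r.1 != origin) ->
  aperiodic_domino d (pickle (rules_instance rs)) <->
  exists x : config d S, obeys rs x /\ aperiodic x.
Proof.
move=> rs0; split.
  case=> I [/(pcan_inj choice.pickleK) <- [x [/(rules_instanceP _ rs0) xrs xa]]].
  exists (fun i => enum_val (x i)); split=> // p /xa [i xi]; exists i.
  by move/enum_val_inj.
case=> x [xrs xa]; exists (rules_instance rs); split=> //.
exists (fun i => enum_rank (x i)); split; last first.
  by move=> p /xa [i xi]; exists i; move/enum_rank_inj.
by apply/rules_instanceP => // u R uR i; rewrite !enum_rankK; apply: xrs.
Qed.

End PairRules.

(** * Computability of the reduction *)

Section RulesComputable.

Variables (d : nat) (S : finType).
Notation pos := (d.-tuple int).

Definition representable (g : nat -> nat) := exists t, forall f n, eval f [:: n] t = g n.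

Lemma representable_computable g : representable g -> computable g.
Proof.
by case=> t tg; exists (fun f v => eval f v t); split=> [|n]; [apply: evalP | apply: tg].
Qed.

Lemma representable_ccons g h : representable g -> representable h ->
  representable (fun n => ccons (g n) (h n)).
Proof. by move=> [t tg] [u uh]; exists (Cons t u) => f n /=; rewrite tg uh. Qed.

Lemma representable_cst c : representable (fun=> c).
Proof. by exists (Cst c). Qed.

Lemma representable_code (T : Type) (g : T -> nat -> nat) (s : seq T) rest :
  (forall a, representable (g a)) ->
  representable (fun n => CodeSeq.code ([seq g a n | a <- s] ++ rest)).
Proof.
move=> rg; elim: s => [|a s IHs]; first exact: representable_cst.
exact: (representable_ccons (rg a) IHs).
Qed.

(** Only the offset of the first rule varies with [n]: its patterns form a fixed list into which
    [pickle (u n)] is plugged, and all other patterns form a constant tail of the code. *)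
Lemma representable_rules (u : nat -> pos) (R : rel S) (rs : seq (rule d S)) :
    representable (fun n => pickle (u n)) ->
  representable (fun n => pickle (rules_instance ((u n, R) :: rs))).
Proof.
move=> ru; pose rest := map (@pickle _) (flatten (map (@forbid d S) rs)).
pose pick n (ab : S * S) : seq (pos * 'I_#|S|) :=
  [:: (origin d, enum_rank ab.1); (u n, enum_rank ab.2)].
have r1 (ab : S * S) : representable (fun n => pickle (pick n ab)).
  apply: representable_ccons; first exact: representable_cst.
  apply: (@representable_ccons (fun n => ccons (pickle (u n)) (ccons _ 0))).
    by apply: representable_ccons ru _; apply: representable_cst.
  exact: representable_cst.
have [t tE] := representable_code [seq ab <- enum {: S * S} | ~~ R ab.1 ab.2] rest r1.
exists (Cons (Cst #|S|) (Cons t (Cst 0))) => f n; rewrite /= tE.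
rewrite -[RHS]/(ccons #|S| (ccons (CodeSeq.code _) 0)); congr (ccons _ (ccons (CodeSeq.code _) 0)).
by rewrite /= [RHS]map_cat -[X in _ = X ++ _]map_comp.
Qed.

End RulesComputable.

(** * The tiling *)

(* Along a line, a marked point is shown by the word 0...0 1 2...2. *)
Definition follows (a b : 'I_3) : bool :=
  ((a == 0 :> nat) && (b <= 1)) || ((0 < a) && (b == 2 :> nat)).

Definition side (v x : int) : 'I_3 :=
  if (x < v)%R then inord 0 else if x == v then inord 1 else inord 2.

Lemma side_lt v x : (side v x == 0 :> nat) = (x < v)%R.
Proof. by rewrite /side; case: ltgtP => /=; rewrite inordK. Qed.

Lemma side_eq v x : (side v x == 1 :> nat) = (x == v).
Proof. by rewrite /side; case: ltgtP => /=; rewrite inordK. Qed.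

Lemma side_gt v x : (side v x == 2 :> nat) = (v < x)%R.
Proof. by rewrite /side; case: ltgtP => /=; rewrite inordK. Qed.

Lemma side_le v x : (side v x <= 1) = (x <= v)%R.
Proof. by rewrite /side; case: ltgtP => /=; rewrite inordK. Qed.

Lemma side_ge v x : (0 < side v x) = (v <= x)%R.
Proof. by rewrite /side; case: ltgtP => /=; rewrite inordK. Qed.

Lemma follows_side v x : follows (side v x) (side v (x + 1)%R).
Proof. by rewrite /follows side_lt side_le side_ge side_gt; lia. Qed.

(** A symbol at most 1 is preceded by 0 and a positive one is followed by 2, so one occurrence of 1
    determines the word. Constant words of 0 or 2 also obey [follows], whence the hypothesis on
    [v]. *)
Lemma follows_line (g : nat -> 'I_3) (v : nat) :
    (forall x, follows (g x) (g x.+1)) -> g v = 1 :> nat ->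
  forall x : nat, g x = side v x.
Proof.
move=> gf gv x; apply: val_inj => /=.
have back i : g i.+1 <= 1 -> g i = 0 :> nat.
  by have := gf i; rewrite /follows; case: eqP => //= _ /andP [_ /eqP ->].
have lt j k : k + j.+1 = v -> g k = 0 :> nat.
  elim: j k => [|j IHj] k kv; apply: back; first by move: kv; rewrite addn1 => ->; rewrite gv.
  by rewrite IHj //; lia.
have gt k : v < k -> g k = 2 :> nat.
  elim: k => // k IHk; rewrite ltnS leq_eqVlt => /orP [/eqP vk | vk].
    by have := gf k; rewrite /follows -vk gv /= => /eqP.
  by have := gf k; rewrite /follows IHk //= => /eqP.
apply/esym/eqP; case: (ltngtP x v) => xv.
- by rewrite (lt (v - x.+1)) ?side_lt; lia.
- by rewrite gt // side_gt; lia.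
- by rewrite xv gv side_eq.
Qed.

Lemma follows_int (g : int -> 'I_3) : (forall x, follows (g x) (g (x + 1)%R)) ->
  g 0%R = 1 :> nat -> forall x, g x = side 0 x.
Proof.
move=> gf g0 [n|n].
  by apply: (follows_line (g := fun n : nat => g n)) => // x; rewrite -addn1 PoszD.
apply: val_inj; apply/esym/eqP => /=.
suff -> : g (Negz n) = 0 :> nat by rewrite side_lt.
elim: n => [|n IHn].
  by have := gf (Negz 0); rewrite /= /follows g0; case: eqP => //= _; rewrite andbF.
have := gf (Negz n.+1); have -> : (Negz n.+1 + 1 = Negz n)%R by lia.
by rewrite /follows IHn andbF orbF; case: eqP.
Qed.

(* The register whose content moves to r (with an increment if the bit is set);
   [None] when r is reset. *)
Definition source (i : instr) (r : nat) : option (nat * bool) :=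
  match i with
  | IZero r0 => if r == r0 then None else Some (r, false)
  | ISucc r0 s => if r == r0 then Some (s, true) else Some (r, false)
  | ICopy r0 s => if r == r0 then Some (s, false) else Some (r, false)
  | _ => Some (r, false)
  end.

Lemma step_source P h q e r :
  (step P h (q, e)).2 r =
    if source (fetch P q) r is Some (s, b) then e s + b else 0.
Proof.
by rewrite /step; case: fetch => [r0|r0 s|r0 s|r0 s t|r0 t] /=; rewrite /upd ?addn0 //;
  case: ifP; rewrite ?addn0 ?addn1.
Qed.

Definition instr_le K (i : instr) : bool :=
  match i with
  | IZero r => r <= K
  | ISucc r s => (r <= K) && (s <= K)
  | ICopy r s => (r <= K) && (s <= K)
  | IJeq r s _ => (r <= K) && (s <= K)
  | IAsk r _ => r <= K
  end.

(** Finitely many registers occur in [P], so a tile can show them all. *)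
Lemma instr_le_ex P r : exists K, all (instr_le K) P && (r <= K).
Proof.
have mono K L i : K <= L -> instr_le K i -> instr_le L i.
  by case: i => [a|a b|a b|a b t|a t] /= KL; lia.
elim: P => [|i P [K /andP [PK rK]]]; first by exists r; rewrite /=.
have [L iL] : exists L, instr_le L i.
  by case: i => [a|a b|a b|a b t|a t];
    [exists a | exists (a + b) | exists (a + b) | exists (a + b) | exists a]; rewrite /=; lia.
exists (K + L); rewrite /= (mono L) ?leq_addl //= (leq_trans rK) ?leq_addr // andbT.
by apply: sub_all PK => j; apply: mono; apply: leq_addr.
Qed.

(** * Tiles and local rules *)

Section Tiling.

Variables (P : seq instr) (mu rho K D : nat).
Notation d := D.+4.
Notation goto t := (minn t (size P)).

(* Layers: position relative to the seed on the axes 0 and 1; machine state; register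
   heads; oracle bit; the two tracks of the loop; and the free bit at the seed. *)
Definition tile : finType :=
  ('I_3 * 'I_3 * 'I_(size P).+1 * {ffun 'I_K.+1 -> 'I_3} * bool * (bool * bool) * bool)%type.

Definition tH (s : tile) : 'I_3 := s.1.1.1.1.1.1.
Definition tV (s : tile) : 'I_3 := s.1.1.1.1.1.2.
Definition tq (s : tile) : nat := s.1.1.1.1.2.
Definition treg (s : tile) (r : nat) : 'I_3 := s.1.1.1.2 (inord r).
Definition torc (s : tile) : bool := s.1.1.2.
Definition tfwd (s : tile) : bool := s.1.2.1.
Definition tbwd (s : tile) : bool := s.1.2.2.
Definition tfree (s : tile) : bool := s.2.

Definition quadrant s := (0 < tH s) && (0 < tV s).
Definition seed s := (tH s == 1 :> nat) && (tV s == 1 :> nat).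
(* The cells of the loop: those up to the head rho of a row in state mu. *)
Definition live s := [&& quadrant s, tq s == mu & treg s rho <= 1].

(** The last clause is the initial row: state 0, and every register except 0 empty, its head being
    at the seed. *)
Definition wf s :=
  [&& tfwd s || tbwd s ==> live s, tfree s ==> seed s &
      seed s ==> (tq s == 0) && [forall r : 'I_K.+1, (r != 0 :> nat) ==> (treg s r == 1 :> nat)]].

(** A jump is decided at the cell that carries the head of [r]: the registers are equal if the other
    head is there too, and the oracle bit of that column is the answer to the query. Since [Rx]
    makes the state constant along a row, one cell suffices. *)
Definition next_ok s s' :=
  match fetch P (tq s) with
  | IJeq r r' t => (treg s r == 1 :> nat) ==>
      (tq s' == goto (if treg s r' == 1 :> nat then t else (tq s).+1))
  | IAsk r t => (treg s r == 1 :> nat) ==>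
      (tq s' == goto (if torc s then t else (tq s).+1))
  | _ => tq s' == goto (tq s).+1
  end.

Definition Rx : rel tile := fun s s' =>
  [&& wf s, tV s == tV s', tq s == tq s', follows (tH s) (tH s') &
      quadrant s ==> [forall r : 'I_K.+1, follows (treg s r) (treg s' r)]].

(** A reset puts the head into column 0, where [tH] is 1. Increments are left to [Rxy]. *)
Definition Ry : rel tile := fun s s' =>
  [&& tH s == tH s', torc s == torc s', follows (tV s) (tV s') &
    quadrant s ==> next_ok s s' && [forall r : 'I_K.+1,
      match source (fetch P (tq s)) r with
      | None => (tH s == 1 :> nat) ==> (treg s' r == 1 :> nat)
      | Some (r', false) => (treg s r' == 1 :> nat) ==> (treg s' r == 1 :> nat)
      | Some (_, true) => true
      end]].

(** An increment moves a head one cell to the right in one time step, hence a diagonal offset. *)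
Definition Rxy : rel tile := fun s s' =>
  quadrant s ==> [forall r : 'I_K.+1,
    if source (fetch P (tq s)) r is Some (r', true)
    then (treg s r' == 1 :> nat) ==> (treg s' r == 1 :> nat) else true].

(** The last two clauses are the ends of the loop: column 0 turns backward signals into forward
    ones, the head of [rho] does the opposite. Between the ends, [Rxz] and [Rzx] move the
    signals. *)
Definition Rz : rel tile := fun s s' =>
  [&& s.1.1 == s'.1.1, tfree s == tfree s',
      live s && (tH s == 1 :> nat) ==> (tfwd s' == tbwd s) &
      live s && (treg s rho == 1 :> nat) ==> (tbwd s' == tfwd s)].

Definition Rxz : rel tile := fun s s' =>
  live s && (treg s rho == 0 :> nat) ==> (tfwd s' == tfwd s).

Definition Rzx : rel tile := fun s s' =>
  live s && (tH s == 2 :> nat) ==> (tbwd s' == tbwd s).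

Definition Rw : rel tile := fun s s' => s.1 == s'.1.

(** The input enters the instance only as the offset of this rule: the head of register 0 is N cells
    to the right of the seed. *)
Definition Rinput : rel tile := fun s s' => seed s ==> (treg s' 0 == 1 :> nat).

Definition ax0 : 'I_d := @Ordinal d 0 isT.
Definition ax1 : 'I_d := @Ordinal d 1 isT.
Definition ax2 : 'I_d := @Ordinal d 2 isT.
Definition ax3 : 'I_d := @Ordinal d 3 isT.

Definition vec (a b c : int) : d.-tuple int :=
  [tuple if k == ax0 then a else if k == ax1 then b else if k == ax2 then c else 0%R | k < d].

Definition unitv (k : 'I_d) : d.-tuple int := [tuple Posz (j == k) | j < d].

Definition fixed_rules : seq (rule d tile) :=
  [:: (vec 1 0 0, Rx); (vec 0 1 0, Ry); (vec 1 1 0, Rxy); (vec 0 0 1, Rz);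
      (vec 1 0 1, Rxz); (vec (-1) 0 1, Rzx)]
  ++ [seq (unitv k, Rw) | k : 'I_d <- enum 'I_d & 2 < (k : nat)].

Definition rules (N : nat) : seq (rule d tile) := (vec N 0 0, Rinput) :: fixed_rules.

Definition pt (a b c : int) : Zd d := rowt (vec a b c).

Lemma ptE a b c k : pt a b c ord0 k =
  (if k == ax0 then a else if k == ax1 then b else if k == ax2 then c else 0)%R.
Proof. by rewrite mxE tnth_mktuple. Qed.

Lemma ptD a b c a' b' c' : (pt a b c + pt a' b' c' = pt (a + a') (b + b') (c + c'))%R.
Proof. by apply/rowP => k; rewrite mxE !ptE; do 3!case: (k == _) => //. Qed.

Lemma pt0 : pt 0 0 0 = 0%R.
Proof. by apply/rowP => k; rewrite ptE mxE !if_same. Qed.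

Lemma vec_neq0 a b c : (a != 0%R) || (b != 0%R) || (c != 0%R) -> vec a b c != origin d.
Proof.
move=> abc; apply: contraL abc => /eqP /(congr1 (@rowt d)); rewrite rowt_origin.
rewrite -/(pt a b c) => /rowP E; have := (E ax0, E ax1, E ax2).
by rewrite !ptE !mxE /= => -[[-> ->] ->].
Qed.

Lemma rules_neq0 N r : 0 < N -> List.In r (rules N) -> r.1 != origin d.
Proof.
move=> N0 /= [<- | ]; first by apply: vec_neq0; rewrite /=; lia.
do 6![case=> [<- | ]; first by apply: vec_neq0].
elim: (enum _) => //= k ks IH; case: ifP => //= _ [<- | /IH //].
apply/eqP => /(congr1 (fun t => tnth t k)); rewrite !tnth_mktuple eqxx.
by [].
Qed.

Record valid (N : nat) (x : config d tile) : Prop := Valid {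
  valid_x : forall i, Rx (x i) (x (i + pt 1 0 0)%R);
  valid_y : forall i, Ry (x i) (x (i + pt 0 1 0)%R);
  valid_xy : forall i, Rxy (x i) (x (i + pt 1 1 0)%R);
  valid_z : forall i, Rz (x i) (x (i + pt 0 0 1)%R);
  valid_xz : forall i, Rxz (x i) (x (i + pt 1 0 1)%R);
  valid_zx : forall i, Rzx (x i) (x (i + pt (-1) 0 1)%R);
  valid_w : forall k : 'I_d, 2 < k -> forall i, Rw (x i) (x (i + rowt (unitv k))%R);
  valid_input : forall i, Rinput (x i) (x (i + pt N 0 0)%R) }.

Lemma validP N x : obeys (rules N) x <-> valid N x.
Proof.
have w_in (k : 'I_d) : 2 < k ->
    List.In (unitv k, Rw) [seq (unitv k, Rw) | k : 'I_d <- enum 'I_d & 2 < (k : nat)].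
  move=> k2; have : k \in enum 'I_d by rewrite mem_enum.
  elim: (enum _) => //= j s IHs; rewrite inE => /orP [/eqP <- | /IHs]; first by rewrite k2; left.
  by case: ifP => // _; right.
split=> [H | H u R /=].
  split=> [||||||k k2|]; apply: H; rewrite /rules /fixed_rules /=; try tauto.
  by do 7!right; apply: w_in.
do 7![case=> [[<- <-] i|]; first by apply H].
elim: (enum _) => //= k s IHs; case: ifP => //= k2 [[<- <-] i|/IHs //].
exact: (valid_w H).
Qed.

Hypotheses (PK : all (instr_le K) P) (rhoK : rho <= K).

Lemma fetch_le q : instr_le K (fetch P q).
Proof.
rewrite /fetch; have [lt_q | le_q] := ltnP q (size P); first exact: (all_nthP _ PK).
by rewrite nth_default.
Qed.

Lemma source_le q r r' b : r <= K -> source (fetch P q) r = Some (r', b) -> r' <= K.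
Proof.
move=> rK; have := fetch_le q; case: fetch => [a|a a'|a a'|a a' t|a t] /= aK;
  try case: ifP => _; try done; case=> <- _; lia.
Qed.

Lemma const_scale (T : Type) (F : Zd d -> T) v :
  (forall i, F (i + v)%R = F i) -> forall z i, F (i + z *: v)%R = F i.
Proof.
move=> Fv.
have Fn (n : nat) i : F (i + Posz n *: v)%R = F i.
  elim: n i => [|n IHn] i; first by rewrite scale0r addr0.
  by rewrite intS scalerDl scale1r addrA IHn.
case=> n i; first exact: Fn.
by rewrite -(Fn n.+1 (i + _)%R) -addrA -scalerDl NegzE addNr scale0r addr0.
Qed.

Lemma const_w (T : Type) (F : Zd d -> T) :
    (forall k : 'I_d, 2 < k -> forall i, F (i + rowt (unitv k))%R = F i) ->
  forall i, F i = F (pt (i ord0 ax0) (i ord0 ax1) (i ord0 ax2)).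
Proof.
move=> Fk i.
set p := pt _ _ _.
(* A position differs from its projection to the first three axes by a combination of the unit
   vectors of the other axes. *)
have iE : i = (p + \sum_(k <- enum 'I_d | (2 < k)%N) i ord0 k *: rowt (unitv k))%R.
  apply/rowP => j; rewrite !mxE summxE tnth_mktuple big_enum_cond /=.
  have [j2 | j2] := ltnP 2 j.
    rewrite (bigD1 j) //= !mxE tnth_mktuple eqxx mulr1 big1 ?addr0; last first.
      by move=> k /andP [_ kj]; rewrite !mxE tnth_mktuple eq_sym (negPf kj) mulr0.
    do 3![case: eqP => [jE | _]; first by rewrite jE in j2].
    by rewrite add0r.
  rewrite big1 ?addr0.
    rewrite -!val_eqE; case: j j2 => -[|[|[|m]]] jP //= _;
      by congr (i _ _); apply: val_inj.
  move=> k k2; rewrite !mxE tnth_mktuple; case: eqP => [jk|]; last by rewrite mulr0.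
  by move: k2; rewrite -jk ltnNge j2.
rewrite [in LHS]iE; elim: (enum _) => [|k s IHs]; first by rewrite big_nil addr0.
rewrite big_cons; case: ifP => // k2.
by rewrite [X in (p + X)%R]addrC addrA (const_scale (Fk k k2)).
Qed.

Lemma pt_scale z a b c : (z *: pt a b c = pt (z * a) (z * b) (z * c))%R.
Proof. by apply/rowP => k; rewrite mxE !ptE; do 3!case: (k == _) => //; rewrite mulr0. Qed.

Lemma const_y (T : Type) (F : Zd d -> T) :
  (forall i, F (i + pt 0 1 0)%R = F i) -> forall a b c, F (pt a b c) = F (pt a 0 c).
Proof.
move=> Fy a b c; rewrite -[RHS](const_scale Fy b) pt_scale ptD.
by rewrite !mulr0 mulr1 !addr0 add0r.
Qed.

Lemma const_x (T : Type) (F : Zd d -> T) :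
  (forall i, F (i + pt 1 0 0)%R = F i) -> forall a b c, F (pt a b c) = F (pt 0 b c).
Proof.
move=> Fx a b c; rewrite -[RHS](const_scale Fx a) pt_scale ptD.
by rewrite !mulr0 mulr1 !addr0 add0r.
Qed.

Lemma const_z (T : Type) (F : Zd d -> T) :
  (forall i, F (i + pt 0 0 1)%R = F i) -> forall a b c, F (pt a b c) = F (pt a b 0).
Proof.
move=> Fz a b c; rewrite -[RHS](const_scale Fz c) pt_scale ptD.
by rewrite !mulr0 mulr1 !addr0 add0r.
Qed.

(** * From aperiodic configurations to unbounded marks *)

Section Sound.

Variables (N : nat) (x : config d tile).
Hypotheses (vx : valid N x) (sx : seed (x 0%R)).

Lemma core_pt a b c : (x (pt a b c)).1.1 = (x (pt a b 0)).1.1.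
Proof.
by apply: (const_z (F := fun i => (x i).1.1)) => i; have /and4P [/eqP] := valid_z vx i.
Qed.

Lemma tH_pt a b c : tH (x (pt a b c)) = side 0 a.
Proof.
have E b' : tH (x (pt a b' 0)) = tH (x (pt a 0 0)).
  apply: (const_y (F := fun i => tH (x i))) => i.
  by have /and4P [/eqP] := valid_y vx i.
rewrite /tH core_pt -/(tH _) E.
apply: (follows_int (g := fun a => tH (x (pt a 0 0)))) => [a'|].
  by have /and5P [_ _ _] := valid_x vx (pt a' 0 0); rewrite ptD !addr0.
by apply/eqP; rewrite pt0; have /andP [] := sx.
Qed.

Lemma tV_pt a b c : tV (x (pt a b c)) = side 0 b.
Proof.
have E a' : tV (x (pt a' b 0)) = tV (x (pt 0 b 0)).
  apply: (const_x (F := fun i => tV (x i))) => i.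
  by have /and5P [_ /eqP] := valid_x vx i.
rewrite /tV core_pt -/(tV _) E.
apply: (follows_int (g := fun b => tV (x (pt 0 b 0)))) => [b'|].
  by have /and4P [_ _] := valid_y vx (pt 0 b' 0); rewrite ptD !addr0.
by apply/eqP; rewrite pt0; have /andP [] := sx.
Qed.

Lemma tq_pt a b c : tq (x (pt a b c)) = tq (x (pt 0 b 0)).
Proof.
rewrite /tq core_pt -!/(tq _); apply: (const_x (F := fun i => tq (x i))) => i.
by have /and5P [_ _ /eqP] := valid_x vx i.
Qed.

Lemma torc_pt a b c : torc (x (pt a b c)) = torc (x (pt a 0 0)).
Proof.
rewrite /torc core_pt -!/(torc _); apply: (const_y (F := fun i => torc (x i))) => i.
by have /and4P [_ /eqP] := valid_y vx i.
Qed.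

Lemma treg_pt a b c r : treg (x (pt a b c)) r = treg (x (pt a b 0)) r.
Proof. by rewrite /treg core_pt. Qed.

Lemma quadrant_pt a b c : quadrant (x (pt a b c)) = (0 <= a)%R && (0 <= b)%R.
Proof. by rewrite /quadrant tH_pt tV_pt !side_ge. Qed.

Lemma row_pt (y : nat) r (v : nat) : r <= K -> treg (x (pt v y 0)) r = 1 :> nat ->
  forall n : nat, treg (x (pt n y 0)) r = side v n.
Proof.
move=> rK rv; apply: follows_line => // n.
have /and5P [_ _ _ _ /implyP] := valid_x vx (pt n y 0).
rewrite quadrant_pt => /(_ isT) /forallP /(_ (inord r)).
by rewrite inordK // ptD !addr0 -PoszD addn1.
Qed.

Let h : oracle := fun n => torc (x (pt n 0 0)).

(** For each register the time rules fix a single cell of row [y.+1], the one with the head;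
    [row_pt] recovers the others. *)
Lemma simulates (y : nat) : tq (x (pt 0 y 0)) = (trace P h N y).1 /\
  forall r, r <= K -> forall n : nat, treg (x (pt n y 0)) r = side ((trace P h N y).2 r) n.
Proof.
elim: y => [|y [IHq IHr]].
  rewrite /trace /=; have /and5P [/and3P [_ _]] := valid_x vx 0%R.
  rewrite sx /= => /andP [/eqP q0 /forallP r0] _ _ _ _; split; first by rewrite pt0.
  move=> r rK; apply: row_pt => //; rewrite /init; case: eqP => [->|/eqP rn0].
    by have /implyP /(_ sx) /eqP := valid_input vx 0%R; rewrite add0r.
  by have /implyP := r0 (inord r); rewrite inordK // pt0 => /(_ rn0) /eqP.
have reg r : r <= K -> (treg (x (pt (Posz ((trace P h N y).2 r)) y 0)) r == 1 :> nat).
  by move=> rK; rewrite IHr // side_eq.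
rewrite /trace iterS -/(trace P h N y); case E: (trace P h N y) => [q e].
rewrite E /= in IHq IHr reg.
have Vy (n : nat) := valid_y vx (pt n y 0).
have Vxy (n : nat) := valid_xy vx (pt n y 0).
have qE (n : nat) : tq (x (pt n y 0)) = q by rewrite tq_pt.
have Vnext (n : nat) : next_ok (x (pt n y 0)) (x (pt n y.+1 0)).
  have /and4P [_ _ _ /implyP] := Vy n; rewrite quadrant_pt => /(_ isT) /andP [+ _].
  by rewrite ptD !addr0 -PoszD addn1.
split.
  have := fetch_le q; rewrite /=; case fq: (fetch P q) => [r|r s|r s|r s t|r t] /= rK.
  - by have := Vnext 0; rewrite /next_ok qE fq => /eqP.
  - by have := Vnext 0; rewrite /next_ok qE fq => /eqP.
  - by have := Vnext 0; rewrite /next_ok qE fq => /eqP.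
  - case/andP: rK => rK sK; have := Vnext (e r).
    by rewrite /next_ok qE fq !IHr // !side_eq eqxx tq_pt eqz_nat => /eqP.
  - have := Vnext (e r).
    by rewrite /next_ok qE fq !IHr // !side_eq eqxx tq_pt torc_pt => /eqP.
move=> r rK; apply: row_pt => //; rewrite step_source.
case Es: (source _ _) => [[s []]|].
- have /implyP := Vxy (e s); rewrite quadrant_pt => /(_ isT) /forallP /(_ (inord r)).
  rewrite inordK // qE Es reg ?(source_le rK Es) //= ptD !addr0 => /eqP.
  by rewrite -!PoszD !addn1.
- have /and4P [_ _ _ /implyP] := Vy (e s).
  rewrite quadrant_pt => /(_ isT) /andP [_] /forallP /(_ (inord r)).
  rewrite inordK // qE Es reg ?(source_le rK Es) //= ptD !addr0 => /eqP.
  by rewrite -!PoszD addn0 addn1.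
- have /and4P [_ _ _ /implyP] := Vy 0.
  rewrite quadrant_pt => /(_ isT) /andP [_] /forallP /(_ (inord r)).
  rewrite inordK // qE Es tH_pt side_eq eqxx /= ptD !addr0 => /eqP.
  by rewrite -!PoszD addn1.
Qed.

Lemma wf_pt i : wf (x i).
Proof. by have /and5P [] := valid_x vx i. Qed.

Lemma live_pt a b c : live (x (pt a b c)) ->
  exists n y : nat, [/\ a = n, b = y, (trace P h N y).1 = mu & n <= (trace P h N y).2 rho].
Proof.
rewrite /live quadrant_pt => /and3P [/andP []].
case: a b => [n|//] [y|//] _ _; rewrite tq_pt treg_pt.
have [-> Hr] := simulates y; rewrite Hr // side_le => /eqP qmu n_le.
by exists n, y.
Qed.

Lemma livez (n y : nat) c : (trace P h N y).1 = mu -> n <= (trace P h N y).2 rho ->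
  live (x (pt n y c)).
Proof.
move=> qmu n_le; rewrite /live quadrant_pt /= tq_pt treg_pt.
by have [-> Hr] := simulates y; rewrite qmu eqxx Hr // side_le.
Qed.

(** A signal makes v steps to the right, turns in one step, makes v steps to the left and turns
    again: 2 (v + 1) steps in all. It is followed from column 0, and the other cells show it with a
    delay. *)
Lemma loop_period (n y : nat) (c : int) (v := (trace P h N y).2 rho) :
    (trace P h N y).1 = mu -> n <= v ->
  tfwd (x (pt n y (c + Posz (v.+1).*2)%R)) = tfwd (x (pt n y c)) /\
  tbwd (x (pt n y (c + Posz (v.+1).*2)%R)) = tbwd (x (pt n y c)).
Proof.
move=> qmu nv.
pose T n c := tfwd (x (pt (Posz n) y c)); pose U n c := tbwd (x (pt (Posz n) y c)).
have trit m c' : treg (x (pt (Posz m) y c')) rho = side v m.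
  by rewrite treg_pt; have [_ ->] := simulates y.
have Tfwd m c' : m < v -> T m.+1 (c' + 1)%R = T m c'.
  move=> mv; have /implyP := valid_xz vx (pt m y c').
  rewrite livez // ?(ltnW mv) // trit side_lt ltz_nat mv => /(_ isT) /eqP.
  by rewrite ptD addr0 -PoszD addn1.
have Ubwd m c' : m < v -> U m (c' + 1)%R = U m.+1 c'.
  move=> mv; have /implyP := valid_zx vx (pt m.+1 y c').
  rewrite livez // tH_pt side_gt => /(_ isT) /eqP.
  by rewrite ptD addr0 -addn1 PoszD addrK.
have T0 c' : T 0 (c' + 1)%R = U 0 c'.
  have /and4P [_ _ /implyP + _] := valid_z vx (pt 0 y c').
  by rewrite (livez (n := 0)) // tH_pt side_eq => /(_ isT) /eqP; rewrite ptD !addr0.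
have Uv c' : U v (c' + 1)%R = T v c'.
  have /and4P [_ _ _ /implyP] := valid_z vx (pt v y c').
  by rewrite (livez (n := v)) // trit side_eq eqxx => /(_ isT) /eqP; rewrite ptD !addr0.
have Tn m c' : m <= v -> T m (c' + Posz m)%R = T 0 c'.
  elim: m c' => [|m IHm] c' mv; first by rewrite addr0.
  by rewrite -addn1 PoszD addrA addn1 Tfwd // IHm // ltnW.
have Un m c' : m <= v -> U (v - m) (c' + Posz m)%R = U v c'.
  elim: m c' => [|m IHm] c' mv; first by rewrite addr0 subn0.
  by rewrite -addn1 PoszD addrA addn1 Ubwd ?subnSK ?IHm //; lia.
have Tper c' : T 0 (c' + Posz (v.+1).*2)%R = T 0 c'.
  have -> : (c' + Posz (v.+1).*2 = ((c' + Posz v + 1) + Posz v) + 1)%R by lia.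
  by rewrite T0 -{1}(subnn v) Un // Uv Tn.
split.
  rewrite -!/(T n _) -[X in T n X](subrK (Posz n)) Tn // -[c in RHS](subrK (Posz n)) Tn //.
  by rewrite addrAC Tper.
(* A backward signal in column [n] has left column 0 after v steps out, one turn and v - n steps
   back. *)
have UE c' : U n c' = T 0 (c' - Posz (v - n) - 1 - Posz v)%R.
  rewrite -(Tn v) // subrK -Uv subrK -(Un (v - n)) ?leq_subr // subrK subKn //.
by rewrite -!/(U n _) !UE -[RHS]Tper; congr (T 0 _); lia.
Qed.

Lemma unbounded_of_aperiodic : aperiodic x -> marks_unbounded P mu rho h N.
Proof.
move=> xa; apply: NNPP => bounded.
have [B HB] : exists B, forall y, (trace P h N y).1 = mu -> (trace P h N y).2 rho < B.
  apply: NNPP => H; apply: bounded => B; apply: NNPP => H'; apply: H; exists B => y yE.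
  by rewrite ltnNge; apply/negP => By; apply: H'; exists y.
(* Marked values are below [B], so every v + 1 divides the factorial of [B] and every loop length 2
   (v + 1) divides its double. *)
pose p := pt 0 0 (Posz (B`!).*2).
have [|i] := xa p.
  move/rowP => /(_ ax2); rewrite ptE mxE /= => E.
  by have := fact_gt0 B; lia.
apply.
have free j : tfree (x (j + p)%R) = tfree (x j).
  have -> : p = (Posz (B`!).*2 *: pt 0 0 1)%R by rewrite pt_scale !mulr0 mulr1.
  by apply: (const_scale (F := fun i => tfree (x i))) => k; have /and4P [_ /eqP] := valid_z vx k.
have wconst := const_w (F := fun i => (x i).1) (fun k k2 i =>
  esym (eqP (valid_w vx k2 i))).
suff E : (x (i + p)%R).1 = (x i).1.
  rewrite [LHS]surjective_pairing [RHS]surjective_pairing E; congr pair; exact: free.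
rewrite wconst [RHS]wconst !mxE !tnth_mktuple /= !addr0.
move: (i _ ax0) (i _ ax1) (i _ ax2) => a b c.
have core : (x (pt a b (c + Posz (B`!).*2)%R)).1.1 = (x (pt a b c)).1.1.
  by rewrite core_pt [RHS]core_pt.
apply/eqP; rewrite -pair_eqE /pair_eq /= core eqxx -pair_eqE /pair_eq /=; apply/andP.
have [/live_pt [n [y [-> -> qmu nv]]] | dead] := boolP (live (x (pt a b c))).
  have /dvdnP [j jE] : ((trace P h N y).2 rho).+1 %| B`!.
    by apply: dvdn_fact; rewrite /= HB.
  suff per k : tfwd (x (pt n y (c + Posz (k * ((trace P h N y).2 rho).+1.*2))%R)) =
          tfwd (x (pt n y c)) /\
        tbwd (x (pt n y (c + Posz (k * ((trace P h N y).2 rho).+1.*2))%R)) =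
          tbwd (x (pt n y c)).
    have [] := per j; rewrite -doubleMr -jE => Ef Eb.
    by split; apply/eqP.
  elim: k => [|k [IHf IHb]]; first by rewrite addr0.
  rewrite mulSnr PoszD addrA -IHf -IHb.
  exact: loop_period.
(* Liveness does not depend on z, and [wf] keeps both tracks empty outside the loops. *)
have dead' : ~~ live (x (pt a b (c + Posz (B`!).*2)%R)).
  by move: dead; rewrite /live /quadrant /tH /tV /tq /treg core.
have off s : wf s -> ~~ live s -> (tfwd s = false) * (tbwd s = false).
  by case/and3P=> + _ _; case: live => //; case: tfwd; case: tbwd.
have [Ef Eb] := off _ (wf_pt _) dead; have [Ef' Eb'] := off _ (wf_pt _) dead'.
by split; apply/eqP; [rewrite [LHS]Ef' [RHS]Ef | rewrite [LHS]Eb' [RHS]Eb].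
Qed.

End Sound.

Lemma valid_shift N x j : valid N x -> valid N (fun i => x (i + j)%R).
Proof.
case=> *; split=> [i|i|i|i|i|i|k k2 i|i]; rewrite addrAC; auto.
Qed.

Lemma aperiodic_shift (x : config d tile) j :
  aperiodic x -> aperiodic (fun i => x (i + j)%R).
Proof.
by move=> xa p /xa [i xi]; exists (i - j)%R; rewrite (addrAC _ p) !subrK.
Qed.

(** Without a seed the free bit vanishes everywhere, and the other layers are constant along axis 3,
    which exists because the dimension is at least 4. *)
Lemma seed_exists N x : valid N x -> aperiodic x -> exists i, seed (x i).
Proof.
move=> vx xa; apply: NNPP => no_seed.
have free i : tfree (x i) = false.
  have /and5P [/and3P [_ /implyP fs _] _ _ _ _] := valid_x vx i.
  by apply/negP => /fs si; apply: no_seed; exists i.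
have [|i] := xa (rowt (unitv ax3)).
  by move/rowP => /(_ ax3); rewrite !mxE tnth_mktuple eqxx.
apply; have /eqP E := valid_w vx (isT : 2 < ax3) i.
rewrite [LHS]surjective_pairing [RHS]surjective_pairing -E; congr pair.
exact: etrans (free _) (esym (free _)).
Qed.

Theorem tiling_sound N x : valid N x -> aperiodic x ->
  exists h, marks_unbounded P mu rho h N.
Proof.
move=> vx xa; have [j sj] := seed_exists vx xa.
have sx : seed (x (0 + j)%R) by rewrite add0r.
by eexists; apply: (unbounded_of_aperiodic (valid_shift j vx) sx (aperiodic_shift j xa)).
Qed.

(** * From unbounded marks to an aperiodic configuration *)

Section Complete.

Variables (h : oracle) (N : nat).

(** Negative rows mirror the others; there the time rules are switched off by [quadrant]. *)
Let row (b : int) := trace P h N `|b|%N.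
Let width (b : int) : int := Posz (((row b).2 rho).+1).*2.
Let on (a b : int) : bool :=
  [&& (0 <= a)%R, (0 <= b)%R, (row b).1 == mu & (a <= Posz ((row b).2 rho))%R].

(* The tracks carry a single signal going around the loop, of period [width b]. *)
Definition run_config : config d tile := fun i =>
  let a := i ord0 ax0 in let b := i ord0 ax1 in let c := i ord0 ax2 in
  (side 0 a, side 0 b, inord (row b).1, [ffun r : 'I_K.+1 => side (Posz ((row b).2 r)) a],
   h `|a|%N,
   (on a b && ((c - a)%R \in dvdz (width b)), on a b && ((c + a + 1)%R \in dvdz (width b))),
   [&& a == 0%R, b == 0%R & [forall k : 'I_d, (2 < k) ==> (i ord0 k == 0%R)]]).

Local Notation x := run_config.

Lemma trace_le y : (trace P h N y).1 <= size P.
Proof.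
case: y => // y; rewrite /trace iterS; case: (iter y _ _) => q e /=.
by case: fetch => *; apply: geq_minr.
Qed.

Lemma run_tq i : tq (x i) = (row (i ord0 ax1)).1.
Proof. by rewrite /tq /= inordK // ltnS trace_le. Qed.

Lemma run_treg i r : r <= K ->
  treg (x i) r = side (Posz ((row (i ord0 ax1)).2 r)) (i ord0 ax0).
Proof. by move=> rK; rewrite /treg /= ffunE inordK. Qed.

Lemma run_live i : live (x i) = on (i ord0 ax0) (i ord0 ax1).
Proof. by rewrite /live /quadrant run_tq run_treg // !side_ge side_le /on -!andbA. Qed.

Lemma row_succ (b : int) : (0 <= b)%R -> row (b + 1)%R = step P h (row b).
Proof. by case: b => // n _; rewrite /row -PoszD addn1 /trace iterS. Qed.

Lemma ptDE (i : Zd d) a b c : [/\ (i + pt a b c)%R ord0 ax0 = (i ord0 ax0 + a)%R,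
  (i + pt a b c)%R ord0 ax1 = (i ord0 ax1 + b)%R,
  (i + pt a b c)%R ord0 ax2 = (i ord0 ax2 + c)%R &
  forall k : 'I_d, 2 < k -> (i + pt a b c)%R ord0 k = i ord0 k].
Proof.
split=> [|||k k2]; rewrite mxE ptE //.
by do 3![case: eqP => [kE | _]; first by rewrite kE in k2]; rewrite addr0.
Qed.

Lemma run_seed i : seed (x i) = (i ord0 ax0 == 0%R) && (i ord0 ax1 == 0%R).
Proof. by rewrite /seed !side_eq. Qed.

Lemma run_wf i : wf (x i).
Proof.
rewrite /wf run_live run_seed; apply/and3P; split.
- by apply/implyP => /orP [] /andP [].
- by apply/implyP => /and3P [-> ->].
apply/implyP => /andP [/eqP a0 /eqP b0]; rewrite run_tq b0 /=; apply/forallP => r.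
apply/implyP => r0; rewrite run_treg ?a0 ?b0 ?side_eq; last by rewrite -ltnS.
by rewrite /row /trace /= /init (negPf r0).
Qed.

Lemma run_valid : valid N x.
Proof.
split=> i.
- have [Ea Eb Ec _] := ptDE i 1 0 0; rewrite /Rx run_wf !run_tq Eb addr0 eqxx.
  rewrite /tH /tV /= Ea Eb addr0 eqxx follows_side /=.
  apply/implyP => _; apply/forallP => r; have rK : r <= K by rewrite -ltnS.
  by rewrite !run_treg // Ea Eb addr0 follows_side.
- have [Ea Eb Ec _] := ptDE i 0 1 0; rewrite /Ry /tH /tV /torc /= Ea Eb addr0 !eqxx.
  rewrite follows_side /=; apply/implyP => /andP [_]; rewrite side_ge => b0.
  apply/andP; split.
    rewrite /next_ok !run_tq Eb row_succ //.
    case: (row _) (fetch_le (row (i ord0 ax1)).1) (fun r => @run_treg i r) => q e /=.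
    case: fetch => [r|r s|r s|r s t|r t] //=.
      case/andP=> rK sK E; apply/implyP; rewrite !E // !side_eq => /eqP ->.
      by rewrite eqz_nat.
    move=> rK E; apply/implyP; rewrite !E // !side_eq => /eqP aE.
    by rewrite /torc /= aE.
  apply/forallP => r; have rK : r <= K by rewrite -ltnS.
  have rE := @step_source P h (row (i ord0 ax1)).1 (row (i ord0 ax1)).2 r.
  rewrite run_tq; case Es: (source _ _) rE => [[s []]|] //; rewrite -surjective_pairing => rE.
    rewrite !run_treg ?(source_le rK Es) // Ea Eb row_succ // rE addn0 addr0.
    exact/implyP.
  by rewrite !run_treg // Ea Eb row_succ // rE addr0; apply/implyP.
- have [Ea Eb Ec _] := ptDE i 1 1 0; rewrite /Rxy /quadrant /tH /tV /= !side_ge.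
  apply/implyP => /andP [a0 b0]; apply/forallP => r; have rK : r <= K by rewrite -ltnS.
  have rE := @step_source P h (row (i ord0 ax1)).1 (row (i ord0 ax1)).2 r.
  rewrite run_tq; case Es: (source _ _) rE => [[s []]|] //; rewrite -surjective_pairing => rE.
  rewrite !run_treg ?(source_le rK Es) // Ea Eb row_succ // rE !side_eq.
  by apply/implyP => /eqP ->; rewrite PoszD.
- have [Ea Eb Ec Ew] := ptDE i 0 0 1; apply/and4P; split.
  + by rewrite /= Ea Eb !addr0.
  + rewrite /tfree /= Ea Eb !addr0; apply/eqP; do 2!congr (_ && _).
    by apply: eq_forallb => k; case k2: (2 < k) => //=; rewrite Ew.
  + apply/implyP => /andP [_]; rewrite /tH side_eq /tfwd /tbwd /= Ea Eb Ec !addr0.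
    by move/eqP => ->; rewrite subr0 addr0.
  + apply/implyP => /andP [_]; rewrite run_treg // side_eq /tfwd /tbwd /= Ea Eb Ec !addr0.
    move/eqP => aE; set w := width _.
    (* At the head, the backward phase one step later exceeds the forward phase by exactly one
       circuit. *)
    have -> : (i ord0 ax2 + 1 + i ord0 ax0 + 1 = i ord0 ax2 - i ord0 ax0 + w)%R.
      by rewrite /w /width aE; lia.
    by rewrite rpredDr ?dvdzz.
- have [Ea Eb Ec _] := ptDE i 1 0 1; rewrite /Rxz run_live run_treg // side_lt.
  apply/implyP => /andP [lv av]; rewrite /tfwd /= Ea Eb Ec addr0 lv /=.
  have -> : on (i ord0 ax0 + 1)%R (i ord0 ax1).
    by case/and4P: lv => ? ? ? ?; apply/and4P; split=> //; lia.
  by rewrite opprD addrACA subrr addr0.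
- have [Ea Eb Ec _] := ptDE i (-1) 0 1; rewrite /Rzx run_live /tH side_gt.
  apply/implyP => /andP [lv a0]; rewrite /tbwd /= Ea Eb Ec addr0 lv /=.
  have -> : on (i ord0 ax0 - 1)%R (i ord0 ax1).
    by case/and4P: lv => ? ? ? ?; apply/and4P; split=> //; lia.
  rewrite (_ : _ + 1 = i ord0 ax2 + i ord0 ax0 + 1)%R //.
  by rewrite addrACA subrr addr0.
- move=> k2 j; rewrite /Rw /= !mxE !tnth_mktuple.
  have ne (l : 'I_d) : l <= 2 -> (l == i) = false.
    by move=> l2; apply/eqP => li; rewrite -li ltnNge l2 in k2.
  by rewrite !ne // !addr0 eqxx.
- have [Ea Eb Ec _] := ptDE i N 0 0; rewrite /Rinput run_seed.
  apply/implyP => /andP [/eqP a0 /eqP b0].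
  by rewrite run_treg // side_eq Ea Eb a0 b0 addr0 add0r.
Qed.

(** A vector with a nonzero component outside axis 2 is broken at the origin, by the seed markers or
    the free bit. A vector along axis 2 is broken in a marked row with a long enough loop. *)
Lemma run_aperiodic : marks_unbounded P mu rho h N -> aperiodic x.
Proof.
move=> unb p p0.
have [/andP [/andP [a0 b0] w0] | H] := boolP ((p ord0 ax0 == 0%R) && (p ord0 ax1 == 0%R) &&
    [forall k : 'I_d, (2 < k) ==> (p ord0 k == 0%R)]); last first.
  exists 0%R; rewrite add0r => /(congr1 (fun s => (tH s == 1 :> nat, tV s == 1 :> nat, tfree s))).
  rewrite /tH /tV /tfree /= !side_eq !mxE !eqxx /= => -[Ea Eb].
  rewrite Ea Eb /= => Ew; case/negP: H; rewrite Ea Eb Ew.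
  by apply/forallP => k; rewrite mxE eqxx implybT.
(* The circuit 2 (v + 1) of this row is longer than [p], so the signal present at the origin of the
   row has not returned after [p] unless [p] is 0. *)
have [y ymu yv] := unb `|p ord0 ax2|%N.
exists (pt 0 y 0); move/(congr1 tfwd); rewrite /tfwd addrC.
have [Ea Eb Ec _] := ptDE p 0 y 0; rewrite /= Ea Eb Ec !ptE /=.
rewrite (eqP a0) (eqP b0) !add0r oppr0 !addr0 dvdz0.
have -> : on 0 y by rewrite /on /row /= ymu eqxx.
rewrite /= => dv; case: p0; apply/rowP => k; rewrite mxE.
have [k2 | k2] := ltnP 2 k; first by apply/eqP; have /forallP/(_ k) := w0; rewrite k2.
have p2 : p ord0 ax2 = 0%R.
  apply/eqP; rewrite -absz_eq0; apply: contraTT dv => p2; rewrite dvdzE.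
  by rewrite gtnNdvd ?lt0n // /width /row /=; lia.
case: k k2 => -[|[|[|m]]] km //= _; [rewrite -(eqP a0)|rewrite -(eqP b0)|rewrite -[RHS]p2];
  by congr (p _ _); apply: val_inj.
Qed.

End Complete.

Theorem tiling_aperiodic N :
  (exists x : config d tile, obeys (rules N) x /\ aperiodic x) <->
  exists h, marks_unbounded P mu rho h N.
Proof.
split=> [[x [/validP vx xa]] | [h unb]]; first exact: tiling_sound vx xa.
exists (run_config h N); split; first by apply/validP; apply: run_valid.
exact: run_aperiodic.
Qed.

End Tiling.

Lemma representable_vec D :
  representable (fun n => pickle (vec D (Posz n.+1) 0 0)).
Proof.
pose tl := CodeSeq.code [seq (pickle (0%R : int)) | _ <- enum 'I_D.+3].
exists (Cons (Cons (Pow2 (Succ (Var 0))) (Cst (ccons 0 0))) (Cst tl)) => f n.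
rewrite [RHS]/(CodeSeq.code (map pickle (tval (vec D (Posz n.+1) 0 0)))) /=.
rewrite enum_ordSl /= -!map_comp pickle_Posz; congr ccons.
rewrite /tl enumT; congr (CodeSeq.code _); apply: eq_map => k.
by rewrite /= !if_same.
Qed.

Theorem theorem17 (d : nat) (hd : 4 <= d) :
  Sigma11_complete (aperiodic_domino d).
Proof.
split; first exact: Sigma11_aperiodic_domino.
case: d hd => [|[|[|[|D]]]] // _ Q /Sigma11_normal_form [G [rG QG]].
(* The machine receives n.+1: the offset of the rule [Rinput] must not vanish. *)
have rF : recursive (fun h (v : 3.-tuple nat) =>
    G h (nth 0 v 0).-1 (nth 0 v 1) (nth 0 v 2)).
  apply: (@recS_comp 3 3 _ (fun _ s => [:: (nth 0 s 0).-1; nth 0 s 1; nth 0 s 2]) _ rG) => //.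
  by case=> [|[|[|]]] // _;
    [exact: (evalP 3 (Pred (Var 0))) | exact: recS_var | exact: recS_var].
have [P [mu [rho search]]] := search_machine rF.
have [K /andP [PK rhoK]] := instr_le_ex P rho.
exists (fun n => pickle (rules_instance (rules P mu rho K D n.+1))); split.
  exact: representable_computable (representable_rules _ _ (representable_vec D)).
move=> n; rewrite aperiodic_domino_rules; last by move=> r; apply: rules_neq0.
rewrite tiling_aperiodic // QG.
split=> -[h H]; exists h; first exact: (iffRL (search h n.+1)).
exact: (iffLR (search h n.+1)).
Qed.
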